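(* Let $\{X_i^{(N)}\}_{1\le i\le N,\,N\in\mathbb N}$ be the triangular array associated with $X=X_A$ as in the context, let $k\ge 1$, and let $\pi\in\mathcal P(k)$ be a partition that is not noncrossing. Then $$\mathrm{St}_\pi=\lim_{N\to\infty}\ \sum_{(i_1,\dots,i_k)\in\{1,\dots,N\}^k_\pi} X^{(N)}_{i_1}X^{(N)}_{i_2}\cdots X^{(N)}_{i_k}=0,$$ where the limit is in operator norm.
   Context: $\mathcal A$ is a finite von Neumann algebra with faithful normal tracial state $\varphi$. $\mu$ is a compactly supported freely infinitely divisible probability measure on $\mathbb R$ with variance $1$, and $\{\mu_t\}_{t\ge 0}$ is its additive free convolution semigroup ($\mu_1=\mu$). A stationary process with freely independent increments is a map $I\mapsto X_I$ from finite half-open intervals $I=[a,b)\subset\mathbb R$ to self-adjoint elements of $\mathcal A$ (extended additively to finite disjoint unions) such that the $X_I$ for disjoint $I$ are freely independent, $X_{I_1}+X_{I_2}=X_J$ when $J=I_1\sqcup I_2$, and $X_I$ has distribution $\mu_{|I|}$. Fix a finite union $A$ of half-open intervals and put $X=X_A$. For each $N$, $X_1^{(N)},\dots,X_N^{(N)}\in\mathcal A$ are self-adjoint, freely independent, identically distributed, with $\sum_{i=1}^N X_i^{(N)}=X$. $\mathcal P(k)$ is the lattice of all partitions of $\{1,\dots,k\}$. A partition $\pi$ is noncrossing if there are no $a<b<c<d$ with $a,c$ in one class of $\pi$ and $b,d$ in a different class. $\{1,\dots,N\}^k_\pi$ is the set of $k$-tuples $(i_1,\dots,i_k)\in\{1,\dots,N\}^k$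 such that $i_a=i_b$ if and only if $a,b$ lie in the same class of $\pi$. *)

(* Defs.v *)
From HB Require Import structures.
From mathcomp Require Import all_boot all_order all_algebra.
From mathcomp Require Import all_classical all_reals all_analysis.
From mathcomp Require Import complex sesquilinear.

Set Implicit Arguments.
Unset Strict Implicit.
Unset Printing Implicit Defensive.

Import Order.TTheory GRing.Theory Num.Theory Num.Def.
Import numFieldNormedType.Exports.

Local Open Scope classical_set_scope.
Local Open Scope ring_scope.

(** * Von Neumann algebras *)

Definition bounded_op (R : realType) (H : normedModType R[i])
    (T : H -> H) : Prop :=
  linear T /\ continuous T.

Definition commutant (R : realType) (H : normedModType R[i])
    (S : set (H -> H)) : set (H -> H) :=
  [set T | bounded_op T /\ forall U, S U -> T \o U = U \o T].

(** A von Neumann algebra is a unital *-algebra of bounded operators on a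
    complex Hilbert space that equals its bicommutant.  It is presented here by
    an algebra [vN_alg] together with a faithful unital *-representation
    [vN_op] on [vN_space] whose image has that property, so that the ring
    operations of the library are available on its elements.  That [vN_star] is
    a conjugate-linear involution follows from [vN_starP] and [vN_op_inj].
    The order on [R[i]] is the partial one: [0 <= z] says that [z] is real and
    nonnegative. *)
Record finiteVN (R : realType) := FiniteVN {
  vN_space : completeNormedModType R[i];
  vN_dot : {dot vN_space for conjC};
  vN_dotE : forall x : vN_space, `|x| ^+ 2 = vN_dot x x;
  vN_alg :> algType R[i];
  vN_op : vN_alg -> vN_space -> vN_space;
  vN_star : vN_alg -> vN_alg;
  vN_op_bounded : forall a, bounded_op (vN_op a);
  vN_op_inj : injective vN_op;
  vN_op_linear : forall (c : R[i]) a b x,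
    vN_op (c *: a + b) x = c *: vN_op a x + vN_op b x;
  vN_op1 : forall x, vN_op 1 x = x;
  vN_opM : forall a b x, vN_op (a * b) x = vN_op a (vN_op b x);
  vN_starP : forall a x y,
    vN_dot (vN_op (vN_star a) x) y = vN_dot x (vN_op a y);
  vN_bicommutant : commutant (commutant (range vN_op)) = range vN_op;
  (* finiteness: every isometry is unitary *)
  vN_finite : forall v, vN_star v * v = 1 -> v * vN_star v = 1
}.

Definition self_adjoint (R : realType) (M : finiteVN R) (a : M) : Prop :=
  vN_star a = a.

Definition op_le (R : realType) (M : finiteVN R) (a b : M) : Prop :=
  forall x : vN_space M, 0 <= vN_dot M (vN_op (b - a) x) x.

Definition opnorm (R : realType) (M : finiteVN R) (a : M) : R :=
  sup [set complex.Re `|vN_op a x| | x in [set x : vN_space M | `|x| <= 1]].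

Definition is_op_lub (R : realType) (M : finiteVN R) (D : set M) (s : M) :=
  [/\ self_adjoint s, forall a, D a -> op_le a s &
      forall u, self_adjoint u -> (forall a, D a -> op_le a u) -> op_le s u].

(** A functional is normal when it preserves suprema of bounded increasing nets
    of self-adjoint elements; the nets are given as upward directed sets. *)
Definition normal_functional (R : realType) (M : finiteVN R)
    (phi : M -> R[i]) : Prop :=
  forall (D : set M) (s : M),
    D !=set0 ->
    (forall a, D a -> self_adjoint a) ->
    (forall a b, D a -> D b -> exists c, [/\ D c, op_le a c & op_le b c]) ->
    is_op_lub D s ->
    supremums [set phi a | a in D] (phi s).

Record tracialVN (R : realType) := TracialVN {
  tr_vN :> finiteVN R;
  tr : tr_vN -> R[i];
  tr_linear : forall (c : R[i]) a b, tr (c *: a + b) = c * tr a + tr b;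
  tr1 : tr 1 = 1;
  tr_ge0 : forall a, 0 <= tr (vN_star a * a);
  tr_trace : forall a b, tr (a * b) = tr (b * a);
  tr_faithful : forall a, tr (vN_star a * a) = 0 -> a = 0;
  tr_normal : normal_functional tr
}.

(** * Free probability *)

Definition free_subalgebras (R : realType) (M : tracialVN R) (I : Type)
    (B : I -> set M) : Prop :=
  forall (n : nat) (i : nat -> I) (a : nat -> M),
    (0 < n)%N ->
    (forall j, (j < n)%N -> B (i j) (a j)) ->
    (forall j, (j.+1 < n)%N -> i j <> i j.+1) ->
    (forall j, (j < n)%N -> tr (a j) = 0) ->
    tr (\prod_(j < n) a j) = 0.

(** For self-adjoint [a] this is also the unital *-subalgebra generated. *)
Definition gen_subalgebra (R : realType) (M : tracialVN R) (a : M) : set M :=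
  [set horner_alg a p | p in [set: {poly R[i]}]].

Definition freely_independent (R : realType) (M : tracialVN R) (I : Type)
    (x : I -> M) : Prop :=
  free_subalgebras (fun i => gen_subalgebra (x i)).

Definition compactly_supported (R : realType) (mu : probability R R) : Prop :=
  exists K : R, mu (~` `[- K, K]) = 0%E.

Definition has_distribution (R : realType) (M : tracialVN R) (a : M)
    (mu : probability R R) : Prop :=
  compactly_supported mu /\
  forall n : nat, tr (a ^+ n) = ((\int[mu]_t (t ^+ n))%R)%:C%C.

Definition identically_distributed (R : realType) (M : tracialVN R) (I : Type)
    (x : I -> M) : Prop :=
  exists nu : probability R R, forall i, has_distribution (x i) nu.

(** [rho] is the free convolution of the family [nu]: the distribution of a sum
    of freely independent self-adjoint elements with distributions [nu i]. *)
Definition is_free_convolution (R : realType) (I : finType)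
    (nu : I -> probability R R) (rho : probability R R) : Prop :=
  exists (M : tracialVN R) (x : I -> M),
    [/\ forall i, self_adjoint (x i),
        freely_independent x,
        forall i, has_distribution (x i) (nu i) &
        has_distribution (\sum_i x i) rho].

Definition freely_infinitely_divisible (R : realType)
    (mu : probability R R) : Prop :=
  forall n : nat, (0 < n)%N ->
    exists nu : probability R R, is_free_convolution (fun _ : 'I_n => nu) mu.

(** Only the values of [mu_] at nonnegative times are relevant; continuity is
    for the topology of weak convergence of measures. *)
Definition free_convolution_semigroup (R : realType)
    (mu_ : R -> probability R R) : Prop :=
  (forall s t : R, 0 <= s -> 0 <= t ->
     is_free_convolution (fun b : bool => if b then mu_ s else mu_ t)
       (mu_ (s + t))) /\
  (forall f : R -> R, continuous f -> (exists K, forall x, `|f x| <= K) ->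
     {within `[0, +oo[, continuous (fun t => (\int[mu_ t]_x f x)%R)}).

(** * Stationary processes with freely independent increments *)

Definition half_open (R : realType) (a b : R) : set R := `[a, b[.

(** The process [X] is regarded as a function of sets; its values are meaningful
    on finite unions of half-open intervals.  [proc_additive] contains both the
    additivity on intervals (when the union is again an interval) and the
    additive extension to finite disjoint unions. *)
Record free_increments_process (R : realType) (M : tracialVN R)
    (mu_ : R -> probability R R) (X : set R -> M) : Prop := {
  proc_sa : forall a b : R, a < b -> self_adjoint (X (half_open a b));
  proc_free : forall (n : nat) (a b : 'I_n -> R),
    (forall j, a j < b j) ->
    trivIset [set: 'I_n] (fun j => half_open (a j) (b j)) ->
    freely_independent (fun j => X (half_open (a j) (b j)));
  proc_additive : forall (n : nat) (a b : 'I_n -> R),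
    (forall j, a j < b j) ->
    trivIset [set: 'I_n] (fun j => half_open (a j) (b j)) ->
    X (\bigcup_(j in [set: 'I_n]) half_open (a j) (b j)) =
      \sum_(j < n) X (half_open (a j) (b j));
  proc_stationary : forall a b : R, a < b ->
    has_distribution (X (half_open a b)) (mu_ (b - a))
}.

Definition finite_union_of_intervals (R : realType) (A : set R) : Prop :=
  exists (n : nat) (a b : 'I_n -> R),
    (forall j, a j < b j) /\ A = \bigcup_(j in [set: 'I_n]) half_open (a j) (b j).

Definition free_triangular_array (R : realType) (M : tracialVN R) (X : M)
    (Y : forall N : nat, 'I_N -> M) : Prop :=
  forall N : nat, (0 < N)%N ->
    [/\ forall i, self_adjoint (Y N i),
        freely_independent (Y N),
        identically_distributed (Y N) &
        \sum_(i < N) Y N i = X].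

(** * Partitions and partition-dependent sums *)

Definition noncrossing (k : nat) (pi : {set {set 'I_k}}) : Prop :=
  ~ exists (B C : {set 'I_k}) (a b c d : 'I_k),
      [/\ B \in pi, C \in pi & B != C] /\
      [/\ (a < b)%N, (b < c)%N & (c < d)%N] /\
      [/\ a \in B, c \in B, b \in C & d \in C].

Definition tuples_of_type (k : nat) (pi : {set {set 'I_k}}) (N : nat) :
    {set {ffun 'I_k -> 'I_N}} :=
  [set i : {ffun 'I_k -> 'I_N} |
    [forall a, forall b, (i a == i b) == (finset.pblock pi a == finset.pblock pi b)]].

Definition partition_sum (R : realType) (M : tracialVN R) (k : nat)
    (pi : {set {set 'I_k}}) (N : nat) (y : 'I_N -> M) : M :=
  \sum_(i in tuples_of_type pi N) \prod_(j < k) y (i j).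

(** [S] is the limit in operator norm of the partition-dependent sums. *)
Definition is_stochastic_measure (R : realType) (M : tracialVN R) (k : nat)
    (pi : {set {set 'I_k}}) (Y : forall N : nat, 'I_N -> M) (S : M) : Prop :=
  opnorm (partition_sum pi (Y N) - S) @[N --> \oo] --> (0 : R).

(* Main.v *)
Require Import Defs.
From HB Require Import structures.
From mathcomp Require Import all_boot all_order all_algebra.
From mathcomp Require Import all_classical all_reals all_analysis.
From mathcomp Require Import complex sesquilinear.
From mathcomp Require Import ring lra.

Set Implicit Arguments.
Unset Strict Implicit.
Unset Printing Implicit Defensive.

Import Order.TTheory GRing.Theory Num.Theory Num.Def.
Import numFieldNormedType.Exports.

Local Open Scope classical_set_scope.
Local Open Scope ring_scope.

(** Write [S] for the partition-dependent sum with [N] summands.  The operator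
    norm is recovered from the trace: it suffices to bound the moments
    [tr ((star S * S) ^ n)] by [D ^ n] for all [n], with [D] of order [1 / N]
    ([op_bound_of_moments]).  This uses square roots in the algebra
    ([op_pos_sqrt]), to test positivity against positive parts, and faithfulness
    of the trace.

    The moment is a sum of mixed moments of the free elements [X_i], indexed by
    the concatenations of [2 n] words of length [k], each of which has the type
    of the partition or of its mirror image.  Let [h = N ^ (- 1 / 2)].  As the
    [X_i] are free and identically distributed with a fixed sum [X], their traces
    are [O(h ^ 2)], their [L^2] norms are [O(h)], and multiplication by [X_i] is
    bounded, uniformly in [N], on the algebra of [X_i]
    ([free_summand_estimates]).  Expanding a product of the [X_i] into reduced
    products of centered elements, one factor at a time, gives two terms at each
    step; therefore a mixed moment is bounded, up to a constant to the power of
    its length, by the sum of [N ^ (- b)] over the noncrossing partitions, with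
    [b] blocks, on the blocks of which the word of indices is constant
    ([tr_word_le]).  The noncrossing partitions are coded by the moves of a stack,
    and their number is exponential in the length.

    A given noncrossing partition with [b] blocks is compatible with [N ^ b]
    words.  If every interval of length [k] has in addition the equalities of a
    crossing partition, then in each interval one more letter is determined,
    either when the word is filled in from the left or when it is filled in from
    the right, and this leaves at most [N ^ (b - n)] words
    ([card_crossing_words]).  The moment is then at most
    [(4 K) ^ (2 n k) N ^ (- n)], and the norm of [S] is at most
    [(4 K) ^ k N ^ (- 1 / 2)]. *)

(** * Hermitian forms *)

Section PositiveForms.
Variables (C : numClosedFieldType) (V : lmodType C) (f : V -> V -> C).
Hypothesis f_linear : forall c u v w, f (c *: u + v) w = c * f u w + f v w.
Hypothesis f_herm : forall u v, f u v = (f v u)^*.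
Hypothesis f_ge0 : forall u, 0 <= f u u.

(** The form may be degenerate: it is applied to the trace and to inner
    products alike. *)
Lemma Cauchy_Schwarz u v : `|f u v| ^+ 2 <= f u u * f v v.
Proof.
have f_linr c x y z : f z (c *: x + y) = c^* * f z x + f z y.
  by rewrite f_herm f_linear rmorphD rmorphM /= -!f_herm.
have f_real x : (f x x)^* = f x x by rewrite -f_herm.
have expand c : f (c *: v + u) (c *: v + u) =
    `|c| ^+ 2 * f v v + (c * f v u + c^* * f u v) + f u u.
  by rewrite f_linear !f_linr normCK; ring.
have vu : f v u = (f u v)^* by rewrite -f_herm.
have [fvv0|fvv_neq0] := eqVneq (f v v) 0.
  (* a degenerate [v]: the form at [u + c v] is affine in [c] *)
  rewrite fvv0 mulr0 le_eqVlt sqrf_eq0 normr_eq0.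
  apply/orP; left; apply/negPn/negP => fuv_neq0.
  have n_gt0 : 0 < `|f u v| ^+ 2 by rewrite exprn_gt0 // normr_gt0.
  pose s := - (f u u + 1) / (2 * `|f u v| ^+ 2).
  have s_real : s^* = s.
    rewrite /s !rmorphM fmorphV rmorphN rmorphD rmorphM /= !rmorphXn /=.
    by rewrite rmorph1 f_real conj_normC rmorph_nat.
  have := f_ge0 ((s * f u v) *: v + u).
  rewrite expand fvv0 mulr0 add0r vu rmorphM /= s_real.
  have -> : s * f u v * (f u v)^* + s * (f u v)^* * f u v + f u u = - 1.
    transitivity (s * `|f u v| ^+ 2 * 2 + f u u); first by rewrite normCK; ring.
    by rewrite /s; field; rewrite normr_eq0.
  by rewrite oppr_ge0 ler10.
have fvv_gt0 : 0 < f v v by rewrite lt_def fvv_neq0 f_ge0.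
have := f_ge0 ((- (f u v / f v v)) *: v + u).
rewrite expand vu normrN normrM normfV (gtr0_norm fvv_gt0) rmorphN rmorphM.
rewrite /= fmorphV /= f_real.
have -> : (`|f u v| / f v v) ^+ 2 * f v v +
    (- (f u v / f v v) * (f u v)^* + - ((f u v)^* / f v v) * f u v) + f u u
    = f u u - `|f u v| ^+ 2 / f v v.
  rewrite exprMn normCK; field; exact: fvv_neq0.
by rewrite subr_ge0 ler_pdivrMr.
Qed.

End PositiveForms.

(** * The involution and the trace *)

Section StarAlgebra.
Variables (R : realType) (M : finiteVN R).
Local Notation C := R[i].
Local Notation H := (vN_space M).
Local Notation dot := (vN_dot M).
Local Notation op := (@vN_op R M).
Local Notation star := (@vN_star R M).
Implicit Types (a b : M) (x y : H) (c : C).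

Lemma vN_ext a b : (forall x, op a x = op b x) -> a = b.
Proof. by move=> ab; apply/vN_op_inj/funext. Qed.

Lemma vN_opD a b x : op (a + b) x = op a x + op b x.
Proof. by rewrite -[a in LHS]scale1r vN_op_linear scale1r. Qed.

Lemma vN_op0 x : op 0 x = 0.
Proof. by apply: (@addIr _ (op 0 x)); rewrite -vN_opD !add0r. Qed.

Lemma vN_opZ c a x : op (c *: a) x = c *: op a x.
Proof. by rewrite -[c *: a]addr0 vN_op_linear vN_op0 addr0. Qed.

Lemma vN_opB a b x : op (a - b) x = op a x - op b x.
Proof. by rewrite vN_opD -scaleN1r vN_opZ scaleN1r. Qed.

Lemma vN_op_vlinear a c x y : op a (c *: x + y) = c *: op a x + op a y.
Proof. by have [-> _] := vN_op_bounded a. Qed.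

Lemma vN_op_vD a x y : op a (x + y) = op a x + op a y.
Proof. by rewrite -[x in LHS]scale1r vN_op_vlinear scale1r. Qed.

Lemma vN_op_v0 a : op a 0 = 0.
Proof. by apply: (@addIr _ (op a 0)); rewrite -vN_op_vD !add0r. Qed.

Lemma dotC x y : dot x y = (dot y x)^*.
Proof. by rewrite hermC expr0 mul1r. Qed.

Lemma dot_linear c x y z : dot (c *: x + y) z = c * dot x z + dot y z.
Proof. by rewrite linearDl linearZl_LR. Qed.

Lemma dot_ext x y : (forall z, dot x z = dot y z) -> x = y.
Proof.
move=> xy; apply/eqP; rewrite -subr_eq0 -(dnorm_eq0 dot).
by rewrite linearBl /= xy subrr.
Qed.

Lemma vN_starPr a x y : dot x (op (star a) y) = dot (op a x) y.
Proof. by rewrite dotC vN_starP -dotC. Qed.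

Lemma star_eq a b : (forall x y, dot (op b x) y = dot x (op a y)) -> star a = b.
Proof.
by move=> ab; apply: vN_ext => x; apply: dot_ext => y; rewrite vN_starP ab.
Qed.

Lemma starK a : star (star a) = a.
Proof. by apply: star_eq => x y; rewrite vN_starPr. Qed.

Lemma starM a b : star (a * b) = star b * star a.
Proof. by apply: star_eq => x y; rewrite !vN_opM !vN_starP. Qed.

Lemma star1 : star 1 = 1.
Proof. by apply: star_eq => x y; rewrite !vN_op1. Qed.

Lemma starD a b : star (a + b) = star a + star b.
Proof.
by apply: star_eq => x y; rewrite !vN_opD linearDl linearDr /= !vN_starP.
Qed.

Lemma starZ c a : star (c *: a) = c^* *: star a.
Proof.
apply: star_eq => x y; rewrite !vN_opZ linearZl_LR linearZr_LR /=.
by rewrite vN_starP.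
Qed.

Lemma star0 : star 0 = 0.
Proof. by rewrite -(scale0r 0) starZ rmorph0 !scale0r. Qed.

Lemma starN a : star (- a) = - star a.
Proof. by rewrite -scaleN1r starZ rmorphN1 scaleN1r. Qed.

Lemma starB a b : star (a - b) = star a - star b.
Proof. by rewrite starD starN. Qed.

Lemma star_sum I (r : seq I) P (F : I -> M) :
  star (\sum_(i <- r | P i) F i) = \sum_(i <- r | P i) star (F i).
Proof. exact: (big_morph star starD star0). Qed.

Lemma starX a n : star (a ^+ n) = star a ^+ n.
Proof.
by elim: n => [|n IH]; rewrite ?expr0 ?star1 // exprS starM IH -exprSr.
Qed.

Lemma dot_Cauchy_Schwarz x y : `|dot x y| <= `|x| * `|y|.
Proof.
rewrite -(@ler_pXn2r _ 2) ?nnegrE ?mulr_ge0 // exprMn !vN_dotE.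
apply: Cauchy_Schwarz => [c u v w|u v|u]; first exact: dot_linear.
- exact: dotC.
- exact: dnorm_ge0.
Qed.

Lemma bounded_opP (T : H -> H) :
  bounded_op T -> exists2 K : C, 0 < K & forall x, `|T x| <= K * `|x|.
Proof.
move=> [linT contT].
pose f := HB.pack_for {linear H -> H} T (GRing.isLinear.Build _ _ _ _ T linT).
have : \forall r \near +oo, forall x, `|f x| <= r * `|x|.
  apply/linear_boundedP; apply/linear_bounded_continuous; exact: contT.
by move=> /pinfty_ex_gt0[r r0 fr]; exists r.
Qed.

Lemma bounded_opI (T : H -> H) (K : C) :
  linear T -> (forall x, `|T x| <= K * `|x|) -> K \is Num.real -> bounded_op T.
Proof.
move=> linT TK Kreal; split=> //.
pose f := HB.pack_for {linear H -> H} T (GRing.isLinear.Build _ _ _ _ T linT).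
apply: (@bounded_linear_continuous _ _ _ f).
apply/linear_boundedP; near=> r => x.
apply: (le_trans (TK x)); apply: ler_wpM2r => //.
Unshelve. all: by end_near. Qed.

End StarAlgebra.

Section TraceCalculus.
Variables (R : realType) (M : tracialVN R).
Local Notation C := R[i].
Local Notation tr := (@tr R M).
Local Notation star := (@vN_star R M).
Implicit Types (a b : M) (c : C).

Lemma trD a b : tr (a + b) = tr a + tr b.
Proof. by rewrite -[a in LHS]scale1r tr_linear mul1r. Qed.

Lemma tr0 : tr 0 = 0.
Proof. by apply: (@addIr _ (tr 0)); rewrite -trD !add0r. Qed.

Lemma trZ c a : tr (c *: a) = c * tr a.
Proof. by rewrite -[c *: a]addr0 tr_linear tr0 addr0. Qed.

Lemma trN a : tr (- a) = - tr a.
Proof. by rewrite -scaleN1r trZ mulN1r. Qed.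

Lemma trB a b : tr (a - b) = tr a - tr b.
Proof. by rewrite trD trN. Qed.

Lemma tr_sum I (r : seq I) P (F : I -> M) :
  tr (\sum_(i <- r | P i) F i) = \sum_(i <- r | P i) tr (F i).
Proof. exact: (big_morph tr trD tr0). Qed.

(** Polarization: the values of the trace at [star (a + 1) * (a + 1)] and at
    [star (a + i) * (a + i)] are real. *)
Lemma tr_star a : tr (star a) = (tr a)^*.
Proof.
have real_sq b : (tr (star b * b))^* = tr (star b * b).
  by apply/CrealP/ger0_real/tr_ge0.
have key c : c^* * tr a + c * tr (star a) =
    (c^* * tr a + c * tr (star a))^*.
  have E : star (a + c *: 1) * (a + c *: 1) =
      star a * a + (c^* *: a + c *: star a) + (c^* * c) *: 1.
    rewrite starD starZ star1 mulrDl !mulrDr.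
    rewrite -!scalerAl -!scalerAr !mul1r !mulr1.
    by rewrite scalerA [c^* *: a + _]addrC !addrA.
  have := real_sq (a + c *: 1); rewrite E !trD !trZ tr1 mulr1.
  have cc : (c^* * c)^* = c^* * c by rewrite rmorphM /= conjCK mulrC.
  by rewrite [LHS]rmorphD [X in X + _]rmorphD /= real_sq cc => /addIr/addrI ->.
have := key 1; have := key 'i.
rewrite !rmorphD !rmorphM /= !conjCK conjCi !rmorph1 !mul1r.
set x := tr a; set y := tr (star a) => Ei E1.
have E2 : y - x = x^* - y^*.
  by apply: (mulfI (neq0Ci _)); rewrite !mulrBr -!mulNr addrC Ei.
have -> : y = ((x + y) + (y - x)) / 2 by field.
by rewrite E1 E2; field.
Qed.

End TraceCalculus.

(** * Limits in operator norm *)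

Section NormLimits.
Variables (R : realType) (M : finiteVN R).
Local Notation C := R[i].
Local Notation H := (vN_space M).
Local Notation dot := (vN_dot M).
Local Notation op := (@vN_op R M).
Local Notation star := (@vN_star R M).
Implicit Types (a b : M) (x y : H) (c : C).

Definition op_bound a c : Prop := forall x, `|op a x| <= c * `|x|.

Lemma complex_archi c : 0 <= c -> exists n, c < n%:R.
Proof.
move=> c0; exists (archi_bound (complex.Re c)).
rewrite -(RRe_real (ger0_real c0)) -[_%:R](rmorph_nat (real_complex R)) ltcR.
by apply: archi_boundP; rewrite -ler0c RRe_real ?ger0_real.
Qed.

(** An infimum equal to zero is enough, since the rates bound constants or
    Cauchy sequences. *)
Definition vanishing (e : nat -> C) : Prop :=
  (forall n, 0 <= e n) /\ forall d, 0 < d -> exists n, e n < d.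

Lemma vanishing_le0 (e : nat -> C) c K :
  vanishing e -> 0 <= K -> (forall n, c <= e n * K) -> c <= 0.
Proof.
move=> [_ e_small] K0 cK; apply/ler_addgt0Pr => d d0; rewrite add0r.
have K1 : 0 < K + 1 by rewrite ltr_wpDl.
have [n en] := e_small (d / (K + 1)) (divr_gt0 d0 K1).
apply: (le_trans (cK n)); apply: (@le_trans _ _ (d / (K + 1) * K)).
  exact: ler_wpM2r (ltW en).
by rewrite mulrAC ler_pdivrMr // ler_pM2l // lerDl.
Qed.

Lemma vanishing_norm0 (V : normedModType C) (e : nat -> C) (v : V) K :
  vanishing e -> 0 <= K -> (forall n, `|v| <= e n * K) -> v = 0.
Proof.
move=> ev K0 vK; apply/eqP; rewrite -normr_le0.
exact: vanishing_le0 ev K0 vK.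
Qed.

(** The norm limit of a sequence of elements of the algebra commutes with the
    commutant, and therefore belongs to the algebra. *)
Lemma vN_norm_complete (z : nat -> M) (e : nat -> C) :
  vanishing e ->
  (forall n m, (n <= m)%N -> op_bound (z m - z n) (e n)) ->
  exists t : M, forall n, op_bound (t - z n) (e n).
Proof.
move=> ev zC; have [e0 e_small] := ev.
have cauchy_z x : cvg ((fun n => op (z n) x) @ \oo).
  apply: cauchy_cvg; apply: cauchy_exP => d /= d0.
  have x1 : 0 < `|x| + 1 by rewrite ltr_wpDl.
  have [n en] := e_small (d / (`|x| + 1)) (divr_gt0 d0 x1).
  exists (op (z n) x); near=> m; rewrite -ball_normE /=.
  rewrite distrC -vN_opB; apply: (@le_lt_trans _ _ (e n * `|x|)).
    by apply: zC; near: m; exact: nbhs_infty_ge.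
  apply: (@le_lt_trans _ _ (e n * (`|x| + 1))); last by rewrite -ltr_pdivlMr.
  by apply: ler_wpM2l => //; rewrite lerDl.
pose T x := lim ((fun n => op (z n) x) @ \oo).
have TzE n x : `|T x - op (z n) x| <= e n * `|x|.
  apply/ler_addgt0Pr => d d0.
  have /cvgrPdist_lt/(_ d d0)[m _ Tm] : op (z k) x @[k --> \oo] --> T x.
    exact: cauchy_z.
  have /ltW Td := Tm (maxn n m) (leq_maxr _ _).
  rewrite [leRHS]addrC -(subrKA (op (z (maxn n m)) x)).
  apply: (le_trans (ler_normD _ _)); apply: lerD => //.
  by rewrite -vN_opB; apply: zC; exact: leq_maxl.
have T_lin : linear T.
  move=> c x y; apply/eqP; rewrite -subr_eq0; apply/eqP.
  apply: (@vanishing_norm0 _ e _ (`|c *: x + y| + `|c| * `|x| + `|y|)) => // n.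
  have -> : T (c *: x + y) - (c *: T x + T y) =
      (T (c *: x + y) - op (z n) (c *: x + y))
      - c *: (T x - op (z n) x) - (T y - op (z n) y).
    by rewrite vN_op_vlinear scalerBr !opprB -addrA (addrACA (c *: _)) -opprD
      subrKA.
  apply: (le_trans (ler_normB _ _)); rewrite mulrDr.
  apply: lerD; last exact: TzE.
  apply: (le_trans (ler_normB _ _)); rewrite mulrDr.
  apply: lerD; first exact: TzE.
  by rewrite normrZ mulrCA; apply: ler_wpM2l => //; exact: TzE.
have T_bounded : bounded_op T.
  have [K K0 zK] := bounded_opP (vN_op_bounded (z 0%N)).
  apply: (@bounded_opI _ _ _ (e 0%N + K)) => // [x|]; last first.
    by apply: ger0_real; rewrite addr_ge0 // ltW.
  rewrite -[T x](subrK (op (z 0%N) x)) mulrDl.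
  by apply: (le_trans (ler_normD _ _)); apply: lerD.
have : commutant (commutant (range op)) T.
  split=> // U [Ubdd UE]; apply: funext => x /=.
  have [K K0 UK] := bounded_opP Ubdd.
  have Usub u v : U (u - v) = U u - U v.
    have U_lin := Ubdd.1; rewrite -[u - v]addrC -scaleN1r U_lin scaleN1r.
    by rewrite addrC.
  apply/eqP; rewrite -subr_eq0; apply/eqP.
  apply: (@vanishing_norm0 _ e _ (`|U x| + K * `|x|)) => // [|n].
    by rewrite addr_ge0 // mulr_ge0 // ltW.
  have Uz : op (z n) (U x) = U (op (z n) x).
    have /UE/(congr1 (fun f => f x)) : range op (op (z n)) by exists (z n).
    by move=> /= ->.
  rewrite -(subrKA (op (z n) (U x))) {2}Uz -Usub mulrDr.
  apply: (le_trans (ler_normD _ _)); apply: lerD; first exact: TzE.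
  apply: (le_trans (UK _)); rewrite mulrCA; apply: ler_wpM2l; first exact: ltW.
  by rewrite distrC; exact: TzE.
rewrite vN_bicommutant => -[t _ tT]; exists t => n x.
by rewrite vN_opB tT; exact: TzE.
Unshelve. all: by end_near. Qed.

End NormLimits.

(** * Square roots of positive elements *)

Section SquareRootIteration.
Variables (R : realType) (M : finiteVN R).
Local Notation C := R[i].
Local Notation H := (vN_space M).
Local Notation dot := (vN_dot M).
Local Notation op := (@vN_op R M).
Local Notation star := (@vN_star R M).
Implicit Types (a b t : M) (x : H) (c : C).

Lemma op_boundD a b c d :
  op_bound a c -> op_bound b d -> op_bound (a + b) (c + d).
Proof.
move=> ac bd x; rewrite vN_opD mulrDl; apply: (le_trans (ler_normD _ _)).
exact: lerD.
Qed.

Lemma op_boundM a b c d :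
  0 <= c -> op_bound a c -> op_bound b d -> op_bound (a * b) (c * d).
Proof.
move=> c0 ac bd x; rewrite vN_opM -mulrA; apply: (le_trans (ac _)).
exact: ler_wpM2l.
Qed.

Lemma op_boundZ a c d : op_bound a d -> op_bound (c *: a) (`|c| * d).
Proof. by move=> ad x; rewrite vN_opZ normrZ -mulrA; apply: ler_wpM2l. Qed.

Lemma op_bound0 : op_bound (0 : M) 0.
Proof. by move=> x; rewrite vN_op0 normr0 mul0r. Qed.

Lemma op_boundN a c : op_bound a c -> op_bound (- a) c.
Proof. by move=> ac x; rewrite -[- a]add0r vN_opB vN_op0 sub0r normrN. Qed.

(** The scalar case [y = 1] of the iteration below. *)
Fixpoint sqrt_rate (n : nat) : R :=
  if n is n'.+1 then (1 + sqrt_rate n' ^+ 2) / 2 else 0.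

Lemma sqrt_rate_itv n : 0 <= sqrt_rate n <= 1.
Proof. by elim: n => [|n /andP[r0 r1]] /=; [lra | apply/andP; split; nra]. Qed.

Lemma sqrt_rate_mono n : sqrt_rate n <= sqrt_rate n.+1.
Proof. by rewrite /=; have := sqrt_rate_itv n; nra. Qed.

(** The distance [d] to the fixed point [1] satisfies [d' = d - d ^ 2 / 2],
    which is solved to first order by [2 / n]. *)
Lemma sqrt_rate_cvg n : 1 - sqrt_rate n <= 2 / n.+2%:R.
Proof.
elim: n => [|n IH]; first by rewrite /=; lra.
have s2 : 2 <= n.+2%:R :> R by rewrite ler_nat.
rewrite -[n.+3]addn1 natrD; move: IH s2.
set s : R := n.+2%:R; set f := 2 / s => IH s2.
have s0 : 0 < s by lra.
have f1 : f <= 1 by rewrite ler_pdivrMr // mul1r.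
have := sqrt_rate_itv n; rewrite [sqrt_rate n.+1]/= => r01.
apply: (@le_trans _ _ (f - f ^+ 2 / 2)); first by nra.
rewrite -subr_ge0.
have -> : 2 / (s + 1) - (f - f ^+ 2 / 2) = 2 / (s ^+ 2 * (s + 1)).
  by rewrite /f; field; apply/andP; split; apply/eqP; lra.
by rewrite divr_ge0 // mulr_ge0 ?sqr_ge0 //; lra.
Qed.

Lemma sqrt_rate_vanishing : vanishing (fun n => (1 - sqrt_rate n)%:C%C : C).
Proof.
split=> [n|d d0]; first by rewrite ler0c; have := sqrt_rate_itv n; lra.
have [n dn] : exists n, 2 / d < n%:R.
  by apply: complex_archi; rewrite divr_ge0 // ltW.
have n0 : 0 < n%:R :> C by apply: le_lt_trans dn; rewrite divr_ge0 // ltW.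
exists n; apply: (@le_lt_trans _ _ (2 / n.+2%:R)); last first.
  rewrite ltr_pdivrMr ?ltr0n // mulrC -ltr_pdivrMr //; apply: (lt_trans dn).
  by rewrite ltr_nat ltnS leqnSn.
have -> : 2 / n.+2%:R = (2 / n.+2%:R : R)%:C%C :> C.
  by rewrite rmorphM fmorphV /= !rmorph_nat.
by rewrite lecR sqrt_rate_cvg.
Qed.

(** The fixed points [z] of the iteration satisfy [(1 - z) ^ 2 = 1 - y]. *)
Fixpoint sqrt_iter (y : M) (n : nat) : M :=
  if n is n'.+1 then 2^-1 *: (y + sqrt_iter y n' * sqrt_iter y n') else 0.

Lemma sqrt_iter_comm y b n :
  b * y = y * b -> b * sqrt_iter y n = sqrt_iter y n * b.
Proof.
move=> yb; elim: n => [|n IH] /=; first by rewrite mulr0 mul0r.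
rewrite -scalerAr -scalerAl mulrDl mulrDr yb; congr (_ *: (_ + _)).
by rewrite mulrA IH -mulrA IH mulrA.
Qed.

Lemma sqrt_iter_sa y n : self_adjoint y -> self_adjoint (sqrt_iter y n).
Proof.
rewrite /self_adjoint => ysa; elim: n => [|n IH] /=; first exact: star0.
by rewrite starZ starD starM IH ysa fmorphV rmorph_nat.
Qed.

Lemma sqrt_iter_bound (y : M) n :
  op_bound y 1 -> op_bound (sqrt_iter y n) (sqrt_rate n)%:C%C.
Proof.
move=> y1; elim: n => [|n IH] /=; first by rewrite rmorph0; exact: op_bound0.
have -> : ((1 + sqrt_rate n ^+ 2) / 2)%:C%C
    = `|2^-1 : C| * (1 + (sqrt_rate n)%:C%C * (sqrt_rate n)%:C%C) :> C.
  rewrite mulrC rmorphM fmorphV rmorph_nat rmorphD rmorph1 rmorphXn expr2.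
  by rewrite ger0_norm // invr_ge0.
apply/op_boundZ/op_boundD => //; apply: op_boundM => //.
by rewrite ler0c; case/andP: (sqrt_rate_itv n).
Qed.

Lemma sqrt_iter_step (y : M) n : op_bound y 1 ->
  op_bound (sqrt_iter y n.+1 - sqrt_iter y n)
           (sqrt_rate n.+1 - sqrt_rate n)%:C%C.
Proof.
move=> y1; elim: n => [|n IH].
  rewrite subr0 /= expr0n addr0 subr0 mulr0 addr0 mul1r.
  have -> : (2^-1)%:C%C = `|2^-1 : C| * 1 :> C.
    by rewrite mulr1 fmorphV rmorph_nat ger0_norm // invr_ge0.
  exact: op_boundZ.
have cm : GRing.comm (sqrt_iter y n.+1) (sqrt_iter y n).
  apply: sqrt_iter_comm; symmetry; exact: sqrt_iter_comm.
set z' := sqrt_iter y n.+1 in IH cm *; set z := sqrt_iter y n in IH cm *.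
have -> : sqrt_iter y n.+2 - z' = 2^-1 *: ((z' - z) * (z' + z)).
  have -> : sqrt_iter y n.+2 = 2^-1 *: (y + z' * z') by [].
  have {2}-> : z' = 2^-1 *: (y + z * z) by [].
  rewrite -scalerBr.
  congr (_ *: _); rewrite opprD addrACA subrr add0r.
  by rewrite mulrDr !mulrBl cm subrKA.
have -> : (sqrt_rate n.+2 - sqrt_rate n.+1)%:C%C = `|2^-1 : C| *
    ((sqrt_rate n.+1 - sqrt_rate n)%:C%C
     * ((sqrt_rate n.+1)%:C%C + (sqrt_rate n)%:C%C)).
  rewrite ger0_norm ?invr_ge0 // -rmorphD -rmorphM.
  rewrite -(rmorph_nat (real_complex R)).
  by rewrite -fmorphV -rmorphM; congr (_%:C%C) => /=; field.
apply/op_boundZ/op_boundM => //.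
- by rewrite ler0c subr_ge0 sqrt_rate_mono.
- by apply: op_boundD; apply: sqrt_iter_bound.
Qed.

Lemma sqrt_iter_cauchy (y : M) n m : op_bound y 1 -> (n <= m)%N ->
  op_bound (sqrt_iter y m - sqrt_iter y n) (sqrt_rate m - sqrt_rate n)%:C%C.
Proof.
move=> y1 /subnK <-; elim: (m - n)%N => [|k IH].
  by rewrite add0n !subrr rmorph0; exact: op_bound0.
rewrite addSn -(subrKA (sqrt_iter y (k + n))) -(subrKA (sqrt_rate (k + n))).
rewrite rmorphD; apply: op_boundD => //; exact: sqrt_iter_step.
Qed.

(** The increments of the iteration are bounded by those of the scalar one, which
    makes it converge in norm even if [1 - y] is not invertible. *)
Lemma contraction_sqrt (y : M) : self_adjoint y -> op_bound y 1 ->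
  exists t : M, [/\ self_adjoint t, op_bound t 1,
    (1 - t) * (1 - t) = 1 - y & forall b, b * y = y * b -> b * t = t * b].
Proof.
move=> ysa y1; pose e n : C := (1 - sqrt_rate n)%:C%C.
pose z := sqrt_iter y.
have ev : vanishing e by exact: sqrt_rate_vanishing.
have [e0 _] := ev.
have zC n m : (n <= m)%N -> op_bound (z m - z n) (e n).
  move=> nm x; apply: (le_trans (sqrt_iter_cauchy y1 nm x)).
  apply: ler_wpM2r => //; rewrite lecR.
  by have /andP[_] := sqrt_rate_itv m; lra.
have [t tz] := vN_norm_complete ev zC.
have [K K0 tK] := bounded_opP (vN_op_bounded t).
have t_fix : 2 *: t - y - t * t = 0.
  apply: vN_ext => x; rewrite vN_op0.
  apply: (@vanishing_norm0 _ _ e _ ((2 + (1 + K)) * `|x|)) => // [|n].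
    by rewrite mulr_ge0 // !addr_ge0 // ltW.
  rewrite mulrA.
  have -> : 2 *: t - y - t * t =
      2 *: (t - z n.+1) + (z n * (z n - t) + (z n - t) * t).
    rewrite /z /= -/(z n) scalerBr scalerA divff ?pnatr_eq0 // scale1r.
    rewrite mulrBr mulrBl subrKA opprD !addrA addrAC.
    by rewrite -[RHS]addrA [_ + (z n * _)]addrC !addrA subrK.
  have -> : e n * (2 + (1 + K)) = `|2| * e n + (1 * e n + e n * K).
    by rewrite ger0_norm //; ring.
  apply: op_boundD; first apply: op_boundZ.
    move=> v; apply: (le_trans (tz n.+1 v)); apply: ler_wpM2r => //.
    by rewrite lecR lerB // sqrt_rate_mono.
  have zt : op_bound (z n - t) (e n) by rewrite -opprB; exact: op_boundN.
  apply: op_boundD; last by apply: op_boundM.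
  apply: op_boundM => // v; apply: (le_trans (sqrt_iter_bound n y1 v)).
  apply: ler_wpM2r => //; rewrite -(rmorph1 (real_complex R)) lecR.
  by case/andP: (sqrt_rate_itv n).
exists t; split.
- apply: star_eq => u v; apply/eqP; rewrite -subr_eq0 -normr_le0.
  apply: (@vanishing_le0 _ e _ (2 * (`|u| * `|v|))) => // n.
  have -> : dot (op t u) v - dot u (op t v) =
      dot (op (t - z n) u) v - dot u (op (t - z n) v).
    rewrite !vN_opB linearBl linearBr /=.
    have -> : dot (op (z n) u) v = dot u (op (z n) v).
      by rewrite -{1}[z n](sqrt_iter_sa n ysa) vN_starP.
    by rewrite opprB subrKA.
  apply: (le_trans (ler_normB _ _)).
  rewrite mulrCA mulr_natl mulr2n; apply: lerD.
    apply: (le_trans (dot_Cauchy_Schwarz _ _)); rewrite mulrA.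
    by apply: ler_wpM2r => //; exact: tz.
  apply: (le_trans (dot_Cauchy_Schwarz _ _)); rewrite mulrCA.
  by apply: ler_wpM2l => //; exact: tz.
- move=> x; rewrite -[t](subrK (z 0%N)).
  have -> : 1 = e 0%N + (sqrt_rate 0)%:C%C.
    by rewrite -rmorphD subrK rmorph1.
  by apply: op_boundD; [exact: tz | exact: sqrt_iter_bound].
- have tt : t * t = t + (t - y).
    move/eqP: t_fix; rewrite subr_eq0 => /eqP <-.
    by rewrite scaler_nat mulr2n addrA.
  by rewrite mulrBl mul1r mulrBr mulr1 tt opprB [t + _]addrC addrK subrKA.
- move=> b yb; apply/eqP; rewrite -subr_eq0; apply/eqP; apply: vN_ext => x.
  rewrite vN_op0.
  have [B B0 bB] := bounded_opP (vN_op_bounded b).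
  apply: (@vanishing_norm0 _ _ e _ ((B + B) * `|x|)) => // [|n].
    by rewrite mulr_ge0 // addr_ge0 // ltW.
  have -> : b * t - t * b = b * (t - z n) - (t - z n) * b.
    by rewrite mulrBr mulrBl (sqrt_iter_comm n yb) opprB subrKA.
  have -> : e n * ((B + B) * `|x|) = (B * e n + e n * B) * `|x| by ring.
  apply: op_boundD; first by apply: op_boundM => //; exact: ltW.
  by apply/op_boundN/op_boundM.
Qed.

Definition op_pos a : Prop := forall x, 0 <= dot (op a x) x.

Lemma sa_dot a x y : self_adjoint a -> dot (op a x) y = dot x (op a y).
Proof. by move=> asa; rewrite -{1}asa vN_starP. Qed.

Lemma sa_dot_real a x : self_adjoint a -> dot (op a x) x \is Num.real.
Proof. by move=> asa; apply/CrealP; rewrite -dotC sa_dot. Qed.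

Lemma op_pos_sqrt a : self_adjoint a -> op_pos a ->
  exists z : M, [/\ self_adjoint z, op_pos z, z * z = a &
    forall b, b * a = a * b -> b * z = z * b].
Proof.
move=> asa a0; have [K K0 aK] := bounded_opP (vN_op_bounded a).
have KV0 : 0 < K^-1 by rewrite invr_gt0.
pose a' := K^-1 *: a; pose y := 1 - a'.
have Kreal : (K^-1)^* = K^-1 by apply/CrealP/gtr0_real.
have a'sa : self_adjoint a' by rewrite /self_adjoint starZ Kreal asa.
have ysa : self_adjoint y by rewrite /self_adjoint starB star1 a'sa.
have a'0 : op_pos a' by move=> x; rewrite vN_opZ linearZl_LR /= mulr_ge0 // ltW.
have y0 : op_pos y.
  move=> x; rewrite vN_opB vN_op1 linearBl /= -vN_dotE subr_ge0.
  rewrite vN_opZ linearZl_LR /= mulrC ler_pdivrMr // -(ger0_norm (a0 x)).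
  apply: (le_trans (dot_Cauchy_Schwarz _ _)).
  by rewrite [leRHS]mulrC expr2 mulrA; apply: ler_wpM2r.
have y1 : op_bound y 1.
  move=> x; rewrite mul1r -(@ler_pXn2r _ 2) ?nnegrE // !vN_dotE.
  rewrite -sa_dot //.
  apply: (@le_trans _ _ (dot (op y x) x)).
    rewrite -subr_ge0 -linearBl /= -vN_opM -vN_opB.
    (* so that [y - y * y] is visibly positive *)
    have -> : y - y * y = y * a' * y + a' * y * a'.
      have -> : a' = 1 - y by rewrite /y opprB addrC subrK.
      have -> : (1 - y) * y = y - y * y by rewrite mulrBl mul1r.
      have -> : y * (1 - y) = y - y * y by rewrite mulrBr mulr1.
      by rewrite [_ * (1 - y)]mulrBr mulr1 [RHS]addrC subrK.
    rewrite vN_opD linearDl /= addr_ge0 //.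
      by rewrite !vN_opM sa_dot.
    by rewrite !vN_opM sa_dot.
  rewrite -subr_ge0 -linearBl /= -{1}[x]vN_op1 -vN_opB /y opprB addrC subrK.
  exact: a'0.
have [t [tsa t1 tt tC]] := contraction_sqrt ysa y1.
have sK : (sqrtC K)^* = sqrtC K.
  by apply/CrealP/ger0_real; rewrite sqrtC_ge0 ltW.
exists (sqrtC K *: (1 - t)); split.
- by rewrite /self_adjoint starZ starB star1 tsa sK.
- move=> x; rewrite vN_opZ linearZl_LR /= mulr_ge0 ?sqrtC_ge0 ?(ltW K0) //.
  rewrite vN_opB vN_op1 linearBl /= subr_ge0 -vN_dotE.
  apply: (le_trans (real_ler_norm (sa_dot_real _ tsa))).
  apply: (le_trans (dot_Cauchy_Schwarz _ _)); rewrite expr2.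
  by apply: ler_wpM2r => //; rewrite -[leRHS]mul1r.
- rewrite -scalerAl -scalerAr scalerA -expr2 sqrtCK tt /y opprB addrC subrK.
  by rewrite scalerA mulfV ?scale1r // gt_eqF.
- move=> b ba; rewrite -scalerAl -scalerAr mulrBl mulrBr mulr1 mul1r tC //.
  by rewrite /y /a' mulrBl mulrBr -scalerAl -scalerAr ba mulr1 mul1r.
Qed.

End SquareRootIteration.

(** * The trace norm and the operator norm *)

Section TraceNorm.
Variables (R : realType) (M : tracialVN R).
Local Notation C := R[i].
Local Notation H := (vN_space M).
Local Notation dot := (vN_dot M).
Local Notation op := (@vN_op R M).
Local Notation tr := (@tr R M).
Local Notation star := (@vN_star R M).
Implicit Types (a b : M) (c : C).

Definition norm2 a : C := sqrtC (tr (star a * a)).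

Lemma norm2_ge0 a : 0 <= norm2 a.
Proof. by rewrite sqrtC_ge0 tr_ge0. Qed.

Lemma norm2_sq a : norm2 a ^+ 2 = tr (star a * a).
Proof. by rewrite sqrtCK. Qed.

Lemma norm2_star a : norm2 (star a) = norm2 a.
Proof. by rewrite /norm2 starK tr_trace. Qed.

Lemma norm2_le a c : 0 <= c -> (norm2 a <= c) = (tr (star a * a) <= c ^+ 2).
Proof.
by move=> c0; rewrite -(@ler_pXn2r _ 2) ?nnegrE ?norm2_ge0 // norm2_sq.
Qed.

Lemma tr_Cauchy_Schwarz_sq a b :
  `|tr (star b * a)| ^+ 2 <= tr (star a * a) * tr (star b * b).
Proof.
pose f (u v : M) := tr (star v * u); apply: (@Cauchy_Schwarz _ _ f).
- by move=> c u v w; rewrite /f mulrDr -scalerAr tr_linear.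
- by move=> u v; rewrite /f -tr_star starM starK.
- by move=> u; exact: tr_ge0.
Qed.

Lemma tr_Cauchy_Schwarz a b : `|tr (star b * a)| <= norm2 a * norm2 b.
Proof.
rewrite -(@ler_pXn2r _ 2) ?nnegrE ?mulr_ge0 ?norm2_ge0 //.
by rewrite exprMn !norm2_sq tr_Cauchy_Schwarz_sq.
Qed.

(** A positive operator is the square of a self-adjoint element. *)
Lemma op_pos_tr a b : self_adjoint a -> op_pos a -> 0 <= tr (star b * a * b).
Proof.
move=> asa a0; have [z [zsa _ <- _]] := op_pos_sqrt asa a0.
rewrite mulrA -{1}zsa -starM -mulrA; exact: tr_ge0.
Qed.

(** The test element is twice the positive part of [a], with [y] the modulus of
    [a]: as [b * a = b * y], the trace of [b * a * b] is nonnegative, and it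
    vanishes only if [b] does, that is, if [a = - y]. *)
Lemma tr_npos_op a : self_adjoint a ->
  (forall b, self_adjoint b -> tr (b * a * b) <= 0) ->
  forall x, dot (op a x) x <= 0.
Proof.
move=> asa tra.
have a2sa : self_adjoint (a * a) by rewrite /self_adjoint starM asa.
have a2pos : op_pos (a * a).
  by move=> x; rewrite vN_opM sa_dot // dnorm_ge0.
have [y [ysa y0 yy yC]] := op_pos_sqrt a2sa a2pos.
have ay : a * y = y * a by apply: yC; rewrite mulrA.
have [z [zsa _ zz _]] := op_pos_sqrt ysa y0.
pose b := y + a.
have bsa : self_adjoint b by rewrite /self_adjoint starD ysa asa.
have ba : b * a = b * y by rewrite !mulrDl -yy -ay addrC.
have zb0 : z * b = 0.
  apply: tr_faithful; apply/eqP; rewrite eq_le tr_ge0 andbT.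
  rewrite starM zsa bsa mulrA -[b * z * z]mulrA zz -ba.
  exact: tra.
have yb0 : y * b = 0 by rewrite -zz -mulrA zb0 mulr0.
have by0 : b * y = 0.
  by have := congr1 star yb0; rewrite starM bsa ysa star0.
have b0 : b = 0.
  by apply: tr_faithful; rewrite bsa {2}/b mulrDr ba by0 addr0 tr0.
have -> : a = - y by apply/eqP; rewrite -addr_eq0 addrC -/b b0.
by move=> x; rewrite -[- y]sub0r vN_opB vN_op0 sub0r linearNl /= oppr_le0.
Qed.

Lemma le1_of_bounded_powers (q K : C) :
  0 <= q -> (forall m, q ^+ (2 ^ m) <= K) -> q <= 1.
Proof.
move=> q0 qK.
have [//|q1] := real_leP (ger0_real q0) (@real1 C).
have K0 : 0 <= K by apply: (le_trans _ (qK 0%N)); rewrite exprn_ge0.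
have d0 : 0 < q - 1 by rewrite subr_gt0.
have [n Kn] : exists n, K / (q - 1) < n%:R.
  by apply: complex_archi; rewrite divr_ge0 // ltW.
have bern k : 1 + (q - 1) *+ k <= q ^+ k.
  elim: k => [|k IH]; first by rewrite mulr0n addr0.
  rewrite exprS; apply: (le_trans _ (ler_wpM2l q0 IH)).
  rewrite -subr_ge0.
  have -> : q * (1 + (q - 1) *+ k) - (1 + (q - 1) *+ k.+1)
    = (q - 1) ^+ 2 *+ k 
    by rewrite mulrS -[(q - 1) *+ k]mulr_natl -[_ ^+ 2 *+ k]mulr_natl; ring.
  by rewrite mulrn_wge0 // exprn_ge0 // ltW.
suff : K < q ^+ (2 ^ n) by move=> /lt_le_trans/(_ (qK n)); rewrite ltxx.
apply: (lt_le_trans _ (bern _)); rewrite ltr_pdivrMr // mulr_natl in Kn.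
apply: (lt_le_trans Kn); rewrite ler_wpDl //.
by apply: ler_wpMn2l; [exact: ltW | exact/ltnW/ltn_expl].
Qed.

(** The operator norm is the limit of the [L^2n] norms of the trace: by
    Cauchy-Schwarz, the moments bound [tr (b * c * b)] for every [b], where
    [c = star a * a], and such values detect positivity of [D - c]. *)
Lemma op_bound_of_moments a (D : C) : 0 < D ->
  (forall n, `|tr ((star a * a) ^+ n)| <= D ^+ n) ->
  forall x, `|op a x| ^+ 2 <= D * `|x| ^+ 2.
Proof.
move=> D0 mom x; pose c := star a * a.
have csa : self_adjoint c by rewrite /self_adjoint starM starK.
have cnsa n : star (c ^+ n) = c ^+ n by rewrite starX csa.
have D_real : D^* = D by apply/CrealP/gtr0_real.
suff : dot (op (c - D *: 1) x) x <= 0.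
  rewrite vN_opB vN_opM vN_opZ vN_op1 linearBl linearZl_LR /= -vN_dotE.
  by rewrite vN_starP -vN_dotE subr_le0.
apply: tr_npos_op => [|b bsa].
  by rewrite /self_adjoint starB starZ star1 csa D_real.
rewrite mulrBr mulrBl trB -scalerAr -scalerAl mulr1 trZ subr_le0.
pose g n := `|tr (b * c ^+ n * b)|.
have g_ge0 n : 0 <= g n by exact: normr_ge0.
have -> : tr (b * c * b) = g 1%N.
  rewrite /g expr1 ger0_norm // -{1}bsa /c !mulrA -starM -mulrA; exact: tr_ge0.
set beta := tr (b * b); set gamma := tr (star (b * b) * (b * b)).
have beta_ge0 : 0 <= beta by rewrite /beta -{1}bsa tr_ge0.
have [beta0|beta_neq0] := eqVneq beta 0.
  have b0 : b = 0 by apply: tr_faithful; rewrite bsa.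
  by rewrite /g b0 !mul0r tr0 normr0 beta0 mulr0.
have beta_gt0 : 0 < beta by rewrite lt_def beta_neq0.
have trcc n : tr (star (c ^+ n * b) * (c ^+ n * b)) = tr (b * c ^+ (2 * n) * b).
  by rewrite starM cnsa bsa !mulrA -[b * _ * _]mulrA -exprD addnn mul2n.
have g_sq n : g n ^+ 2 <= beta * g (2 * n)%N.
  have := tr_Cauchy_Schwarz_sq (c ^+ n * b) b; rewrite bsa mulrA trcc.
  move=> /le_trans; apply; rewrite mulrC; apply: ler_wpM2l => //.
  by apply/real_ler_norm/ger0_real; rewrite -trcc tr_ge0.
have g_bnd n : g n ^+ 2 <= gamma * D ^+ (2 * n).
  have -> : g n = `|tr (star (c ^+ n) * (b * b))|.
    by rewrite /g cnsa -mulrA tr_trace mulrA.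
  apply: (le_trans (tr_Cauchy_Schwarz_sq _ _)); rewrite -/gamma.
  rewrite cnsa -exprD addnn -mul2n.
  apply: ler_wpM2l; first exact: tr_ge0.
  apply: (le_trans _ (mom _)); apply: real_ler_norm; apply: ger0_real.
  by have := tr_ge0 (c ^+ n); rewrite cnsa -exprD addnn -mul2n.
(* doubling the exponent again and again costs one factor [beta] only *)
have iter m : beta * g 1%N ^+ (2 ^ m) <= beta ^+ (2 ^ m) * g (2 ^ m)%N.
  elim: m => [|m IH]; first by rewrite expn0 !expr1.
  rewrite -(ler_pM2l beta_gt0).
  apply: (@le_trans _ _ ((beta ^+ (2 ^ m) * g (2 ^ m)%N) ^+ 2)).
    rewrite mulrA -expr2 expnSr exprM -exprMn.
    by rewrite ler_pXn2r ?nnegrE ?mulr_ge0 ?exprn_ge0 ?g_ge0.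
  rewrite exprMn -exprM -expnSr [leRHS]mulrCA; apply: ler_wpM2l.
    by rewrite exprn_ge0.
  by apply: (le_trans (g_sq _)); rewrite -expnS.
rewrite -[leRHS]mul1r -ler_pdivrMr ?mulr_gt0 //.
apply: (@le1_of_bounded_powers _ (sqrtC gamma / beta)).
  by rewrite divr_ge0 // ?mulr_ge0 // ltW.
move=> m; rewrite expr_div_n ler_pdivrMr ?exprn_gt0 ?mulr_gt0 //.
rewrite mulrAC ler_pdivlMr // mulrC; apply: (le_trans (iter m)).
rewrite exprMn [leRHS]mulrA [leRHS]mulrC; apply: ler_wpM2l.
  by rewrite exprn_ge0.
rewrite -(@ler_pXn2r _ 2) ?nnegrE ?mulr_ge0 ?exprn_ge0 ?sqrtC_ge0
  ?tr_ge0 ?(ltW D0) //.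
by rewrite exprMn sqrtCK -exprM mulnC; exact: g_bnd.
Qed.

End TraceNorm.

(** * Noncrossing partitions and the count of crossing words *)

Section StackCodes.

(** The first flag says that the letter opens a block, the second one that it
    closes the block to which it belongs. *)
Definition step := (bool * bool)%type.

Definition opens (e : step) : bool := e.1.
Definition closes (e : step) : bool := e.2.

(** A code is a noncrossing partition read from left to right: each letter opens
    a block on top of a stack or else joins the block on top, and the block is
    then popped if it is closed.  Compatibility means that the word is constant
    on the blocks; [st] has the letters of the blocks that are open at the
    start. *)
Fixpoint compatible (T : eqType) (u st : seq T) (s : seq step) : bool :=
  match u, s with
  | [::], [::] => nilp st
  | i :: u', e :: s' =>
    let st' := if opens e then i :: st else st in
    if st' is j :: st'' then
      (i == j) && compatible u' (if closes e then st'' else st') s'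
    else false
  | _, _ => false
  end.

(** Twice the number of blocks, for a code that some word is compatible with; the
    two ends of a block are counted separately because each of them carries a
    factor [N ^ (- 1 / 2)] in the expansion of a moment. *)
Definition weight (s : seq step) : nat :=
  (\sum_(e <- s) (opens e + closes e))%N.

Variable s : nat -> step.

(** The stack of open blocks before position [p] is read; a block is named by
    its first position. *)
Fixpoint stack (p : nat) : seq nat :=
  if p is q.+1 then
    let st := if opens (s q) then q :: stack q else stack q in
    if closes (s q) then behead st else st
  else [::].

Definition stack_in (p : nat) : seq nat :=
  if opens (s p) then p :: stack p else stack p.

Definition block (p : nat) : nat := head 0%N (stack_in p).

Lemma stackS p :
  stack p.+1 = if closes (s p) then behead (stack_in p) else stack_in p.
Proof. by []. Qed.

Lemma mem_stack p q : q \in stack p -> (q < p)%N && opens (s q).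
Proof.
have in_st r t : (forall t, t \in stack r -> (t < r)%N && opens (s t)) ->
    t \in stack_in r -> (t < r.+1)%N && opens (s t).
  move=> IH; rewrite /stack_in; case: ifP => [p_op|_].
    rewrite inE => /predU1P[->|/IH/andP[tr ->]]; first by rewrite p_op ltnSn.
    by rewrite ltnS ltnW.
  by move=> /IH/andP[tr ->]; rewrite ltnS ltnW.
elim: p q => [//|p IH] q; rewrite stackS.
case: ifP => _; last exact: in_st.
by move=> /mem_behead; exact: in_st.
Qed.

Variable m : nat.
Hypothesis stack_in_neq0 : forall p, (p < m)%N -> stack_in p != [::].
Hypothesis stack_end : stack m = [::].

Lemma block_opens p : opens (s p) -> block p = p.
Proof. by rewrite /block /stack_in => ->. Qed.

Lemma block_lt p : (p < m)%N -> ~~ opens (s p) -> (block p < p)%N.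
Proof.
move=> pm p_op; have := stack_in_neq0 pm; rewrite /block /stack_in (negPf p_op).
case E: (stack p) => [//|q st] _ /=.
by have /mem_stack/andP[] : q \in stack p by rewrite E mem_head.
Qed.

Lemma opens_block p : (p < m)%N -> opens (s (block p)).
Proof.
move=> pm; have [p_op|p_op] := boolP (opens (s p)).
  by rewrite block_opens.
have := stack_in_neq0 pm; rewrite /block /stack_in (negPf p_op).
case E: (stack p) => [//|q st] _ /=.
by have /mem_stack/andP[] : q \in stack p by rewrite E mem_head.
Qed.

Lemma stack_persist p0 p l st : (p0 <= p)%N -> stack p0 = l :: st ->
  (exists q, [/\ (p0 <= q < p)%N, closes (s q) & block q = l]) \/
  exists2 x, stack p = x ++ l :: st & all (leq p0) x.
Proof.
move=> /subnK <- st0; elim: (p - p0)%N => [|n IH]; first by right; exists [::].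
rewrite addSn.
case: IH => [[q [/andP[pq qn] cq bq]]|[x stx x0]].
  by left; exists q; rewrite pq cq bq ltnS ltnW.
set r := (n + p0)%N in stx *.
have [y sty y0] : exists2 y, stack_in r = y ++ l :: st & all (leq p0) y.
  rewrite /stack_in stx; case: ifP => _; last by exists x.
  by exists (r :: x); rewrite //= leq_addl.
rewrite stackS sty; case: ifP => [cr|_]; last by right; exists y.
case: y sty y0 => [str _|t y _ /andP[_ y0]]; last by right; exists y.
by left; exists r; rewrite leq_addl ltnS leqnn cr /block str.
Qed.

Lemma block_later p : (p < m)%N -> ~~ closes (s p) ->
  exists q, [/\ (p < q)%N, (q < m)%N & block q = block p].
Proof.
move=> pm cp; have := stack_in_neq0 pm.
case E: (stack_in p) => [//|l st] _.
have st1 : stack p.+1 = l :: st by rewrite stackS (negPf cp) E.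
have bp : block p = l by rewrite /block E.
case: (stack_persist pm st1) => [[q [/andP[pq qm] _ bq]]|[x]].
  by exists q; rewrite bq bp.
by rewrite stack_end; case: x.
Qed.

(** As long as the block of [p] is not closed, the top of the stack is that block
    or one that was opened after [p]. *)
Lemma block_noncrossing p q : (p < q)%N -> (q < m)%N -> block p <> block q ->
  (p < block q)%N \/
  exists l, [/\ (p <= l < q)%N, closes (s l) & block l = block p].
Proof.
move=> pq qm bpq; have pm := ltn_trans pq qm.
have [cp|cp] := boolP (closes (s p)).
  by right; exists p; rewrite leqnn pq cp.
have := stack_in_neq0 pm; case E: (stack_in p) => [//|l st] _.
have st1 : stack p.+1 = l :: st by rewrite stackS (negPf cp) E.
have bp : block p = l by rewrite /block E.
case: (stack_persist pq st1) => [[r [/andP[pr rq] cr br]]|[x stx x0]].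
  by right; exists r; rewrite (ltnW pr) rq cr br bp.
have [q_op|q_op] := boolP (opens (s q)); first by left; rewrite block_opens.
have bq : block q = head 0%N (x ++ l :: st).
  by rewrite /block /stack_in (negPf q_op) stx.
case: x x0 bq {stx} => [_ /= bq|y x /= /andP[py _] bq].
  by case: bpq; rewrite bp bq.
by left; rewrite bq.
Qed.

End StackCodes.

Lemma compatible_stack (T : eqType) (i0 : T) (u : seq T) (c : seq step) :
  compatible u [::] c ->
  let s := nth (false, false) c in
  [/\ size u = size c,
      forall p, (p < size c)%N -> stack_in s p != [::],
      forall p, (p < size c)%N -> nth i0 u (block s p) = nth i0 u p &
      stack s (size c) = [::]].
Proof.
move=> uc s.
have size_uc st : compatible u st c -> size u = size c.
  by elim: u st c {uc s} => [|i u IH] st [|e c] //=; case: ifP => _;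
    [|case: st => [//|j st]] => /andP[_ /IH ->].
have suc : size u = size c := size_uc _ uc.
have drop_compat p : (p <= size c)%N ->
    compatible (drop p u) (map (nth i0 u) (stack s p)) (drop p c).
  elim: p => [|p IH] pc; first by rewrite !drop0.
  move: (IH (ltnW pc)).
  rewrite (drop_nth i0) ?suc // (drop_nth (false, false)) //=.
  rewrite -/(s p).
  have -> : (if opens (s p) then nth i0 u p :: map (nth i0 u) (stack s p)
      else map (nth i0 u) (stack s p)) = map (nth i0 u) (stack_in s p).
    by rewrite /stack_in; case: ifP.
  rewrite -/(stack_in s p); case: (stack_in s p) => [//|q st] /= /andP[_].
  by case: ifP.
have step_compat p : (p < size c)%N ->
    if map (nth i0 u) (stack_in s p) is j :: _ then nth i0 u p == j else false.
  move=> pc; have := drop_compat p (ltnW pc).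
  rewrite (drop_nth i0) ?suc // (drop_nth (false, false)) //= -/(s p).
  have -> : (if opens (s p) then nth i0 u p :: map (nth i0 u) (stack s p)
      else map (nth i0 u) (stack s p)) = map (nth i0 u) (stack_in s p).
    by rewrite /stack_in; case: ifP.
  by case: (stack_in s p) => [//|q st] /= /andP[].
split => //.
- by move=> p /step_compat; case: (stack_in s p).
- move=> p /step_compat; rewrite /block.
  by case: (stack_in s p) => [//|q st] /= /eqP.
- have := drop_compat _ (leqnn _); rewrite drop_size drop_oversize ?suc //=.
  by case: (stack s (size c)).
Qed.

(** A word is determined, by induction on the rank [r], by its letters at the
    positions outside [F]. *)
Lemma card_forced (I : finType) (m : nat) (Z : seq (seq I)) (i0 : I)
    (F : pred 'I_m) (r : 'I_m -> nat) :
  uniq Z -> (forall u, u \in Z -> size u = m) ->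
  (forall p, F p -> exists2 q, (r q < r p)%N &
     forall u, u \in Z -> nth i0 u q = nth i0 u p) ->
  (size Z <= #|I| ^ #|[pred p | ~~ F p]|)%N.
Proof.
move=> uZ szZ forced.
pose f (u : seq I) := [ffun p : 'I_m => if F p then i0 else nth i0 u p].
have f_inj : {in Z &, injective f}.
  move=> u v uin vin fuv.
  have nth_uv n : forall p, (r p < n)%N -> nth i0 u p = nth i0 v p.
    elim: n => [//|n IH] p rp.
    have [Fp|Fp] := boolP (F p).
      have [q rq eq_q] := forced p Fp.
      by rewrite -!eq_q // IH // (leq_trans rq).
    by have := congr1 (fun g => fun_of_fin g p) fuv; rewrite !ffunE (negPf Fp).
  apply: (@eq_from_nth _ i0) => [|p]; first by rewrite !szZ.
  by rewrite szZ // => pm; apply: (nth_uv (r (Ordinal pm)).+1 (Ordinal pm)).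
rewrite -(size_map f).
apply: (@leq_trans #|pffun_on i0 [pred p | ~~ F p] I|); last first.
  by rewrite card_pffun_on.
rewrite cardE; apply: uniq_leq_size; first by rewrite map_inj_in_uniq.
move=> _ /mapP[u uin ->]; rewrite mem_enum.
apply/pffun_onP; split; last by [].
apply/supportP => p; rewrite !inE negbK ffunE => ->.
by [].
Qed.

(** In the absence of further constraints, a compatible word is free at the first
    positions of the blocks if it is filled in from the left, and free at the
    last positions if it is filled in from the right.  Consider an interval in
    which the letters at [a < b < d < e] satisfy [v a = v d] and [v b = v e], with
    [v b <> v d].  Then [b] and [d] are in different blocks, and either the block
    of [d] opens after [b], so that its first letter is forced by the letter at
    [a] on the left, or the block of [b] closes before [d], so that its last
    letter is forced by the letter at [e] on the right.  Multiplying the bounds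
    obtained from the two directions gains one factor [N] for each interval. *)
Lemma card_crossing_words (I : finType) (k L : nat) (Z : seq (seq I))
    (c : seq step) (i0 : I) :
  uniq Z -> size c = (L * k)%N ->
  (forall u, u \in Z -> compatible u [::] c) ->
  (forall j, (j < L)%N -> exists a b d e,
     [/\ (a < b)%N, (b < d)%N, (d < e)%N, (e < k)%N &
     forall u, u \in Z ->
     let v p := nth i0 u (j * k + p) in
     [/\ v a = v d, v b = v e & v b <> v d]]) ->
  (size Z ^ 2 * #|I| ^ L <= #|I| ^ weight c)%N.
Proof.
move=> uZ; set m := (L * k)%N => szc compZ crossZ.
case: Z uZ compZ crossZ => [//|u0 Z'] /=; set Z := u0 :: Z' => uZ compZ crossZ.
have u0Z : u0 \in Z by rewrite mem_head.
pose s := nth (false, false) c.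
have [_ stn _ ste] := compatible_stack i0 (compZ _ u0Z).
rewrite szc in stn ste.
have szZ u : u \in Z -> size u = m.
  by move=> /compZ/(compatible_stack i0)[-> _ _ _].
have blockZ p u : (p < m)%N -> u \in Z -> nth i0 u (block s p) = nth i0 u p.
  move=> pm uin; have [_ _ E _] := compatible_stack i0 (compZ _ uin).
  by apply: E; rewrite szc.
pose same (p q : nat) := all (fun u => nth i0 u p == nth i0 u q) Z.
(* positions forced from the left, and from the right *)
pose FL := [pred p : 'I_m | [exists q : 'I_m, (q < p)%N && same q p]].
pose FR := [pred p : 'I_m | [exists q : 'I_m, (p < q)%N && same q p]].
have cardL : (size Z <= #|I| ^ #|[pred p | ~~ FL p]|)%N.
  apply: (@card_forced _ _ _ i0 _ (fun p => p : nat)) => // p.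
  by move=> /existsP[q /andP[qp /allP E]]; exists q => // u /E/eqP.
have cardR : (size Z <= #|I| ^ #|[pred p | ~~ FR p]|)%N.
  apply: (@card_forced _ _ _ i0 _ (fun p : 'I_m => (m - p)%N)) => // p.
  move=> /existsP[q /andP[pq /allP E]]; exists q => [|u /E/eqP //].
  by apply: ltn_sub2l => //; exact: ltn_ord.
have sameI p q : (forall u, u \in Z -> nth i0 u p = nth i0 u q) -> same p q.
  by move=> E; apply/allP => u /E ->.
have FLI (p : 'I_m) q : (q < p)%N ->
    (forall u, u \in Z -> nth i0 u q = nth i0 u p) -> FL p.
  move=> qp E; apply/existsP; exists (Ordinal (ltn_trans qp (ltn_ord p))).
  by rewrite qp sameI.
have FRI (p : 'I_m) q : (p < q)%N -> (q < m)%N ->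
    (forall u, u \in Z -> nth i0 u q = nth i0 u p) -> FR p.
  by move=> pq qm E; apply/existsP; exists (Ordinal qm); rewrite pq sameI.
have FL_joins (p : 'I_m) : ~~ opens (s p) -> FL p.
  move=> p_op; apply: (FLI _ (block s p)) => [|u uin]; last exact: blockZ.
  exact: block_lt stn _ _ p_op.
have FR_stays (p : 'I_m) : ~~ closes (s p) -> FR p.
  move=> cp; have [q [pq qm bq]] := block_later stn ste (ltn_ord p) cp.
  by apply: (FRI _ q) => // u uin; rewrite -(blockZ q) // bq blockZ.
pose D := [pred p : 'I_m | (opens (s p) && FL p) || (closes (s p) && FR p)].
have D_large : (L <= #|D|)%N.
  rewrite -(size_iota 0 L) cardE -(size_map (fun p : 'I_m => (p %/ k)%N)).
  apply: uniq_leq_size; first exact: iota_uniq.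
  move=> j; rewrite mem_iota add0n => /andP[_ jL].
  have [a [b [d [e [ab bd de ek Hv]]]]] := crossZ j jL.
  have k0 : (0 < k)%N by apply: leq_ltn_trans ek.
  have inm r : (r < k)%N -> (j * k + r < m)%N.
    move=> rk; apply: (@leq_trans (j * k + k)); first by rewrite ltn_add2l.
    by rewrite -mulSnr leq_mul2r jL orbT.
  have dk : (d < k)%N := ltn_trans de ek.
  have bk : (b < k)%N := ltn_trans bd dk.
  pose B := (j * k + b)%N; pose D' := (j * k + d)%N.
  have BD : (B < D')%N by rewrite ltn_add2l.
  have block_BD : block s B <> block s D'.
    move=> E; have [_ _] := Hv _ u0Z; apply.
    by rewrite -(blockZ _ _ (inm _ bk)) // -(blockZ _ _ (inm _ dk)) // E.
  have in_interval p : (B <= p <= D')%N -> (p %/ k = j)%N.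
    move=> /andP[Bp pD].
    have jp : (j * k <= p)%N := leq_trans (leq_addr _ _) Bp.
    rewrite -(subnKC jp) divnMDl // divn_small ?addn0 //.
    by rewrite ltn_subLR //; apply: leq_ltn_trans pD _; rewrite ltn_add2l.
  have [Bf|[l [/andP[Bl lD] cl bl]]] :=
    block_noncrossing stn BD (inm _ dk) block_BD.
  - set f := block s D' in Bf.
    have fD : (f <= D')%N.
      have [p_op|p_op] := boolP (opens (s D')); first by rewrite /f block_opens.
      exact: ltnW (block_lt stn (inm _ dk) p_op).
    have fm : (f < m)%N := leq_ltn_trans fD (inm _ dk).
    apply/mapP; exists (Ordinal fm); last first.
      by rewrite /= in_interval // (ltnW Bf) fD.
    rewrite mem_enum inE; apply/orP; left; apply/andP; split.
      by rewrite /=; apply: opens_block stn _ (inm _ dk).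
    apply: (FLI _ (j * k + a)%N) => [|u uin] /=.
      by apply: leq_trans Bf; rewrite ltnS leq_add2l ltnW.
    by have [-> _ _] := Hv _ uin; rewrite /f blockZ // inm.
  - have lm : (l < m)%N := ltn_trans lD (inm _ dk).
    apply/mapP; exists (Ordinal lm); last first.
      by rewrite /= in_interval // Bl ltnW.
    rewrite mem_enum inE; apply/orP; right; apply/andP; split; first exact: cl.
    apply: (FRI _ (j * k + e)%N) => [||u uin] /=; last 1 first.
    + have [_ <- _] := Hv _ uin.
      by rewrite -(blockZ _ _ lm) // bl blockZ // inm.
    + by apply: ltn_trans lD _; rewrite ltn_add2l.
    + exact: inm.
have count_le : (#|[pred p | ~~ FL p]| + #|[pred p | ~~ FR p]| + #|D|
    <= weight c)%N.
  rewrite /weight (big_nth (false, false)) big_mkord szc.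
  have card_sum (P : pred 'I_m) : #|P| = (\sum_(p < m) P p)%N.
    rewrite -sum1_card big_mkcond; apply: eq_bigr => p _.
    by rewrite unfold_in; case: (P p).
  rewrite !card_sum -!big_split; apply: leq_sum => p _; rewrite -/(s p).
  have := FL_joins p; have := FR_stays p.
  rewrite /= ; case: (opens _); case: (closes _) => /=;
  case: [exists _, _]; case: [exists _, _] => //= A B;
  by [|have := A isT|have := B isT].
have I0 : (0 < #|I|)%N by apply/card_gt0P; exists i0.
apply: (@leq_trans
    (#|I| ^ (#|[pred p | ~~ FL p]| + #|[pred p | ~~ FR p]| + #|D|))).
  rewrite !expnD expnS expn1; apply: leq_mul; first exact: leq_mul.
  by apply: leq_pexp2l.
exact: leq_pexp2l.
Qed.

(** * Mixed moments of free elements *)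

Section FreeExpansion.
Variables (R : realType) (M : tracialVN R).
Local Notation C := R[i].
Local Notation tr := (@tr R M).
Local Notation star := (@vN_star R M).

Definition all_steps : seq step :=
  [:: (true, false); (true, true); (false, false); (false, true)].

Fixpoint codes (n : nat) : seq (seq step) :=
  if n is n'.+1 then [seq e :: c | e <- all_steps, c <- codes n']
  else [:: [::]].

Lemma size_codes n : size (codes n) = (4 ^ n)%N.
Proof. by elim: n => [//|n IH]; rewrite size_allpairs IH expnS. Qed.

Lemma size_in_codes n c : c \in codes n -> size c = n.
Proof.
elim: n c => [|n IH] c; first by rewrite inE => /eqP ->.
by move=> /allpairsP[[e c'] [_ /IH <- ->]].
Qed.

Lemma big_codes n (F : seq step -> C) : \sum_(c <- codes n.+1) F c =
  \sum_(e <- all_steps) \sum_(c <- codes n) F (e :: c).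
Proof. exact: big_allpairs_dep. Qed.

Lemma weight_cons e c : weight (e :: c) = (opens e + closes e + weight c)%N.
Proof. by rewrite /weight big_cons. Qed.

Lemma norm2_centered (a : M) : norm2 (a - tr a *: 1) <= norm2 a.
Proof.
rewrite norm2_le ?norm2_ge0 // norm2_sq.
have -> : tr (star (a - tr a *: 1) * (a - tr a *: 1))
    = tr (star a * a) - `|tr a| ^+ 2.
  rewrite starB starZ star1 mulrBl !mulrBr -!scalerAl -!scalerAr !mul1r !mulr1.
  by rewrite !trB !trZ tr1 mulr1 tr_star normCK; ring.
by rewrite gerBl exprn_ge0.
Qed.

Lemma tr_centered (a : M) : tr (a - tr a *: 1) = 0.
Proof. by rewrite trB trZ tr1 mulr1 subrr. Qed.

Lemma gen_subalgebra_self (a : M) : gen_subalgebra a a.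
Proof. by exists 'X => //; rewrite horner_algX. Qed.

Lemma gen_subalgebraM (a b c : M) :
  gen_subalgebra a b -> gen_subalgebra a c -> gen_subalgebra a (b * c).
Proof. by move=> [p _ <-] [q _ <-]; exists (p * q); rewrite // rmorphM. Qed.

Lemma gen_subalgebraD (a b c : M) :
  gen_subalgebra a b -> gen_subalgebra a c -> gen_subalgebra a (b + c).
Proof. by move=> [p _ <-] [q _ <-]; exists (p + q); rewrite // rmorphD. Qed.

Lemma gen_subalgebraZ (a b : M) (x : C) :
  gen_subalgebra a b -> gen_subalgebra a (x *: b).
Proof.
move=> [p _ <-]; exists (x *: p) => //.
by rewrite -mul_polyC rmorphM /= horner_algC -scalerAl mul1r.
Qed.

Lemma gen_subalgebra_scalar (a : M) (x : C) : gen_subalgebra a (x *: 1).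
Proof. by exists x%:P => //; rewrite horner_algC. Qed.

Lemma gen_subalgebra_centered (a b : M) (x : C) :
  gen_subalgebra a b -> gen_subalgebra a (b - x *: 1).
Proof.
by move=> ab; rewrite -scaleNr; apply: gen_subalgebraD => //;
  exact: gen_subalgebra_scalar.
Qed.

Lemma gen_subalgebra_star (a b : M) : self_adjoint a ->
  gen_subalgebra a b -> gen_subalgebra a (star b).
Proof.
move=> asa [p _ <-]; elim/poly_ind: p => [|p x [q _ qE]].
  by exists 0 => //; rewrite !rmorph0 star0.
exists ('X * q + (x^*)%:P) => //.
rewrite !rmorphD !rmorphM /= !horner_algX !horner_algC qE.
by rewrite starD starM starZ star1 asa.
Qed.

Variables (I : eqType) (y : I -> M).
Hypothesis y_free : freely_independent y.

(** The hypotheses of freeness on the factors of a product, with the last factor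
    at the head of the list. *)
Fixpoint reduced (st : seq (I * M)) : Prop :=
  if st is x :: st' then
    [/\ gen_subalgebra (y x.1) x.2, tr x.2 = 0,
        (if st' is z :: _ then x.1 <> z.1 else True) & reduced st']
  else True.

Definition stack_prod (st : seq (I * M)) : M := \prod_(x <- rev st) x.2.

Lemma stack_prod_cons x st : stack_prod (x :: st) = stack_prod st * x.2.
Proof. by rewrite /stack_prod rev_cons big_rcons. Qed.

Lemma reduced_nth x0 st : reduced st -> forall j, (j < size st)%N ->
  [/\ gen_subalgebra (y (nth x0 st j).1) (nth x0 st j).2,
      tr (nth x0 st j).2 = 0 &
      (j.+1 < size st)%N -> (nth x0 st j).1 <> (nth x0 st j.+1).1].
Proof.
elim: st => [//|x st IH] /= [xg x0' xz /IH{}IH] [|j] jst /=; last exact: IH.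
by split=> //; case: st xz {IH jst}.
Qed.

Lemma tr_reduced x st : reduced (x :: st) -> tr (stack_prod (x :: st)) = 0.
Proof.
move=> red; have nthP := reduced_nth x red.
set st' := x :: st in red nthP *.
rewrite /stack_prod (big_nth x) big_mkord.
apply: (y_free (n := size (rev st')) (i := fun j => (nth x (rev st') j).1)
  (a := fun j => (nth x (rev st') j).2)).
- by rewrite size_rev.
- move=> j; rewrite size_rev => jn; rewrite nth_rev //.
  by have [] // := nthP (size st' - j.+1)%N; rewrite ltn_subrL.
- move=> j; rewrite size_rev => jn; rewrite !nth_rev //; last exact: ltnW.
  have E : (size st' - j.+1 = (size st' - j.+2).+1)%N by rewrite subnSK.
  have [|_ _ H] := nthP (size st' - j.+2)%N; first by rewrite ltn_subrL.
  by rewrite E => /esym; apply: H; rewrite -E ltn_subrL.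
- move=> j; rewrite size_rev => jn; rewrite nth_rev //.
  by have [] // := nthP (size st' - j.+1)%N; rewrite ltn_subrL.
Qed.

Variables (K h : C).
Hypotheses (K0 : 0 <= K) (h0 : 0 <= h).
Hypothesis y_tr : forall i, `|tr (y i)| <= K * h ^+ 2.
Hypothesis y_norm2 : forall i, norm2 (y i) <= K * h.
Hypothesis y_mul : forall i b, gen_subalgebra (y i) b ->
  norm2 (b * y i) <= K * norm2 b.

(** The bound for a mixed moment: for an empty stack, each noncrossing
    partition with [b] blocks, on the blocks of which the word is constant,
    contributes [K ^ size u * h ^ (2 b)]. *)
Definition code_sum (u st : seq I) : C :=
  \sum_(c <- codes (size u))
    (compatible u st c)%:R * (K ^+ size u * h ^+ weight c).


Lemma code_sum_ge0 u st : 0 <= code_sum u st.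
Proof.
by apply: sumr_ge0 => c _; rewrite !mulr_ge0 ?exprn_ge0 ?ler0n.
Qed.

(** The codes in which the letter opens a block; those in which it joins the
    block on top, if there are any, only increase the right-hand side. *)
Lemma code_sum_push i u st :
  K * h * code_sum u (i :: st) + K * h ^+ 2 * code_sum u st
  <= code_sum (i :: u) st.
Proof.
rewrite [leRHS]/code_sum [size (_ :: _)]/= big_codes !big_cons big_nil /=.
rewrite addr0 addrA -[leLHS]addr0; apply: lerD; last first.
  by rewrite addr_ge0 // sumr_ge0 // => c _;
    rewrite !mulr_ge0 ?exprn_ge0 ?ler0n.
rewrite /code_sum !mulr_sumr le_eqVlt; apply/orP; left; apply/eqP.
by congr (_ + _); apply: eq_bigr => c _;
  rewrite eqxx weight_cons exprD !exprS expr0; ring.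
Qed.

Lemma code_sum_join i u st :
  K * code_sum u (i :: st) + K * h * code_sum u st
  <= code_sum (i :: u) (i :: st).
Proof.
rewrite [leRHS]/code_sum [size (_ :: _)]/= big_codes !big_cons big_nil /=.
rewrite addr0 addrA -[leLHS]add0r; apply: lerD.
  by rewrite addr_ge0 // sumr_ge0 // => c _;
    rewrite !mulr_ge0 ?exprn_ge0 ?ler0n.
rewrite /code_sum !mulr_sumr le_eqVlt; apply/orP; left; apply/eqP.
by congr (_ + _); apply: eq_bigr => c _;
  rewrite eqxx weight_cons exprD !exprS expr0; ring.
Qed.

(** If the last factor [b] of a reduced product is in the algebra of [y i], then
    multiplication by [y i] replaces [b] by the centered part of [b * y i], and
    adds [tr (b * y i)] times the product without [b]; otherwise it appends the
    centered part of [y i], and adds [tr (y i)] times the product.  There are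
    only two terms at each step, and freeness annihilates every product that is
    not empty at the end.  The norms in [L^2] are under control all along: each
    end of a block costs a factor [h]. *)
Lemma tr_word_le u st : reduced st ->
  `|tr (stack_prod st * \prod_(i <- u) y i)|
    <= code_sum u (map fst st) * \prod_(x <- st) norm2 x.2.
Proof.
elim: u st => [|i u IH] st red.
  rewrite big_nil mulr1 /code_sum big_seq1 /= /weight big_nil !expr0 !mulr1.
  case: st red => [_|x st red]; last by rewrite tr_reduced // normr0 mul0r.
  by rewrite /stack_prod !big_nil tr1 normr1 mulr1.
rewrite big_cons; set U := \prod_(j <- u) y j.
have prod_ge0 (s : seq (I * M)) : 0 <= \prod_(x <- s) norm2 x.2.
  by apply: prodr_ge0 => x _; exact: norm2_ge0.
have [top_i|] := pselect (exists b st', st = (i, b) :: st').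
  have [b [st' E]] := top_i; rewrite {}E {top_i} in red *.
  case: red => /= bg b0 bst' red'; set b' := b * y i.
  have b'g : gen_subalgebra (y i) b'.
    by apply: gen_subalgebraM => //; exact: gen_subalgebra_self.
  pose bc := b' - tr b' *: 1.
  have -> : stack_prod ((i, b) :: st') * (y i * U)
      = stack_prod ((i, bc) :: st') * U + tr b' *: (stack_prod st' * U).
    rewrite !stack_prod_cons /= /bc mulrBr mulrBl -scalerAr mulr1 -scalerAl.
    by rewrite subrK /b' !mulrA.
  rewrite trD trZ; apply: (le_trans (ler_normD _ _)); rewrite normrM.
  rewrite big_cons /=; apply: (le_trans _ (ler_wpM2r _ (code_sum_join _ _ _))).
    rewrite mulrDl; apply: lerD.
      apply: (le_trans (IH ((i, bc) :: st') _)).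
        by split=> //; [exact: gen_subalgebra_centered | exact: tr_centered].
      rewrite big_cons /= [K * _]mulrC -[leRHS]mulrA; apply: ler_wpM2l.
        exact: code_sum_ge0.
      rewrite mulrA; apply: ler_wpM2r => //.
      by apply: (le_trans (norm2_centered _)); exact: y_mul.
    have trb' : `|tr b'| <= K * h * norm2 b.
      have -> : b' = star (star b) * y i by rewrite starK.
      apply: (le_trans (tr_Cauchy_Schwarz _ _)); rewrite norm2_star.
      by apply: ler_wpM2r; [exact: norm2_ge0 | exact: y_norm2].
    apply: (le_trans (ler_pM _ _ trb' (IH st' red'))) => //.
    by rewrite le_eqVlt; apply/orP; left; apply/eqP; ring.
  by rewrite mulr_ge0 ?norm2_ge0.
move=> top_i; pose yc := y i - tr (y i) *: 1.
have red' : reduced ((i, yc) :: st).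
  split=> //=; last first.
  - case: st top_i {red} => [//|[j b] st] top_i /= ij.
    by apply: top_i; exists b, st; rewrite ij.
  - exact: tr_centered.
  - by apply: gen_subalgebra_centered; exact: gen_subalgebra_self.
have -> : stack_prod st * (y i * U)
    = stack_prod ((i, yc) :: st) * U + tr (y i) *: (stack_prod st * U).
  rewrite !stack_prod_cons /= /yc mulrBr mulrBl -scalerAr mulr1 -scalerAl.
  by rewrite subrK !mulrA.
rewrite trD trZ; apply: (le_trans (ler_normD _ _)); rewrite normrM.
apply: (le_trans _ (ler_wpM2r _ (code_sum_push _ _ _))) => //.
rewrite mulrDl; apply: lerD.
  apply: (le_trans (IH _ red')); rewrite big_cons /= mulrA.
  apply: ler_wpM2r => //; rewrite mulrC; apply: ler_wpM2r.
    exact: code_sum_ge0.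
  exact: le_trans (norm2_centered _) (y_norm2 i).
by rewrite -[leRHS]mulrA; apply: ler_pM => //; exact: IH.
Qed.

End FreeExpansion.

(** * Free identically distributed summands *)

Section FreeSummands.
Variables (R : realType) (M : tracialVN R).
Local Notation C := R[i].
Local Notation tr := (@tr R M).
Local Notation star := (@vN_star R M).

Lemma tr_free_pair (I : Type) (y : I -> M) i j a b :
  freely_independent y -> i <> j ->
  gen_subalgebra (y i) a -> gen_subalgebra (y j) b -> tr (a * b) = tr a * tr b.
Proof.
move=> y_free ij ag bg.
have : tr ((a - tr a *: 1) * (b - tr b *: 1)) = 0.
  have := y_free 2 (fun l => if l is 0%N then i else j)
    (fun l => if l is 0%N then a - tr a *: 1 else b - tr b *: 1).
  rewrite big_ord_recl big_ord1; apply=> // [[|[|//]] _|[|//] _|[|[|//]] _] //.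
  - exact: gen_subalgebra_centered.
  - exact: gen_subalgebra_centered.
  - exact: tr_centered.
  - exact: tr_centered.
rewrite mulrBl !mulrBr -!scalerAl -!scalerAr !mul1r !mulr1.
rewrite !trB !trZ tr1 mulr1 => /eqP; rewrite [tr b * tr a]mulrC subrr subr0.
by rewrite subr_eq0 => /eqP.
Qed.

(** A quadratic form bounded by [K] on the algebra generated by [x] makes [x]
    act on it with norm at most [K], since
    [2 K (K ^ 2 - x ^ 2)] is the sum of [(K - x) (K + x) (K - x)] and of
    [(K + x) (K - x) (K + x)]. *)
Lemma norm2_mul_of_form (x b : M) (K : C) :
  self_adjoint x -> 0 < K ->
  (forall c, gen_subalgebra x c -> 0 <= tr (star c * (K *: 1 - x) * c)) ->
  (forall c, gen_subalgebra x c -> 0 <= tr (star c * (K *: 1 + x) * c)) ->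
  gen_subalgebra x b -> norm2 (b * x) <= K * norm2 b.
Proof.
move=> xsa K0 q_ge0 p_ge0 bg.
rewrite -[norm2 (b * x)]norm2_star -[norm2 b]norm2_star starM xsa.
set c := star b.
have cg : gen_subalgebra x c by exact: gen_subalgebra_star.
rewrite norm2_le ?mulr_ge0 ?norm2_ge0 ?(ltW K0) // exprMn norm2_sq.
set p := K *: 1 + x in p_ge0; set q := K *: 1 - x in q_ge0.
have K_real : K^* = K by apply/CrealP/gtr0_real.
have psa : star p = p by rewrite starD starZ star1 K_real xsa.
have qsa : star q = q by rewrite starB starZ star1 K_real xsa.
have pqE : p * q = K ^+ 2 *: 1 - x * x.
  rewrite mulrDl !mulrBr -!scalerAl -!scalerAr !mul1r !mulr1 scalerA.
  by rewrite -expr2 subrKA.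
have qpE : q * p = p * q.
  rewrite pqE mulrBl !mulrDr -!scalerAl -!scalerAr !mul1r !mulr1 scalerA.
  by rewrite -expr2 opprD addrA addrK.
have pg : gen_subalgebra x p.
  by apply: gen_subalgebraD; [exact: gen_subalgebra_scalar
    | exact: gen_subalgebra_self].
have qg : gen_subalgebra x q.
  apply: gen_subalgebraD; first exact: gen_subalgebra_scalar.
  by rewrite -scaleN1r; apply: gen_subalgebraZ; exact: gen_subalgebra_self.
have : 0 <= tr (star (q * c) * p * (q * c)) + tr (star (p * c) * q * (p * c)).
  by apply: addr_ge0; [apply: p_ge0 | apply: q_ge0]; exact: gen_subalgebraM.
have -> : star (q * c) * p * (q * c) = star c * (p * q) * (q * c).
  by rewrite starM qsa -!mulrA [q * (p * _)]mulrA qpE !mulrA.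
have -> : star (p * c) * q * (p * c) = star c * (p * q) * (p * c).
  by rewrite starM psa !mulrA.
rewrite -trD -mulrDr -mulrDl.
have -> : q + p = (2 * K) *: 1.
  by rewrite addrCA subrK -scalerDl mulr_natl mulr2n.
rewrite -scalerAl mul1r -scalerAr trZ pmulr_rge0 ?mulr_gt0 //.
rewrite pqE mulrBr mulrBl trB -scalerAr -scalerAl mulr1 trZ subr_ge0.
by rewrite starM xsa !mulrA.
Qed.

(** The summand [y i] is the conditional expectation of the sum on the algebra
    that it generates, up to a scalar; this bounds it uniformly in the number
    [N] of summands.  The trace and the second moment are of order [1 / N]. *)
Lemma free_summand_estimates (X : M) : exists2 K : C, 1 <= K &
  forall (N : nat) (y : 'I_N -> M), (0 < N)%N ->
    (forall i, self_adjoint (y i)) -> freely_independent y ->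
    identically_distributed y -> \sum_i y i = X ->
    let h := sqrtC (N%:R^-1) in
    [/\ forall i, `|tr (y i)| <= K * h ^+ 2,
        forall i, norm2 (y i) <= K * h &
        forall i b, gen_subalgebra (y i) b -> norm2 (b * y i) <= K * norm2 b].
Proof.
have [K0 K0_gt0 XK0] := bounded_opP (vN_op_bounded X).
pose T := tr X.
exists (K0 + 2 * `|T| + norm2 X + 1).
  by rewrite lerDr !addr_ge0 ?norm2_ge0 ?mulr_ge0 ?(ltW K0_gt0).
set K := _ + 1.
have norm2X_ge0 := norm2_ge0 X.
have KX : norm2 X <= K.
  by rewrite /K -addrA addrCA lerDl !addr_ge0 ?mulr_ge0 ?(ltW K0_gt0).
have KT : `|T| <= K.
  rewrite -subr_ge0; have -> : K - `|T| = K0 + `|T| + norm2 X + 1.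
    by rewrite /K; ring.
  by rewrite !addr_ge0 ?(ltW K0_gt0).
have KK : K0 + 2 * `|T| <= K by rewrite /K -addrA lerDl addr_ge0.
have K_gt0 : 0 < K by rewrite ltr_wpDl // !addr_ge0 ?mulr_ge0 ?(ltW K0_gt0).
clearbody K.
move=> N y N0 ysa y_free [nu y_nu] sumy h.
have N_gt0 : 0 < N%:R :> C by rewrite ltr0n.
have h2 : h ^+ 2 = N%:R^-1 by rewrite sqrtCK.
have h_ge0 : 0 <= h by rewrite sqrtC_ge0 invr_ge0 ltW.
have same_moments n i j : tr (y i ^+ n) = tr (y j ^+ n).
  by have [_ ->] := y_nu i; have [_ ->] := y_nu j.
have Xsa : self_adjoint X.
  by rewrite /self_adjoint -sumy star_sum; apply: eq_bigr => i _; exact: ysa.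
pose t := T / N%:R.
have ytr i : tr (y i) = t.
  have := congr1 tr sumy; rewrite tr_sum (eq_bigr (fun=> tr (y i))).
    rewrite sumr_const card_ord -mulr_natr /t /T => <-.
    by rewrite mulfK // gt_eqF.
  by move=> j _; rewrite -[y j]expr1 -[y i]expr1; exact: same_moments.
have T_real : T \is Num.real by apply/CrealP; rewrite /T -tr_star Xsa.
have t_real : t \is Num.real by rewrite /t rpredM // rpredV realn.
have tT : `|t| <= `|T|.
  rewrite normrM normfV [`|N%:R|]gtr0_norm // ler_pdivrMr //.
  by rewrite ler_peMr // ler1n.
have yg i : gen_subalgebra (y i) (y i) by exact: gen_subalgebra_self.
have norm2y i : norm2 (y i) <= K * h.
  rewrite norm2_le ?mulr_ge0 ?(ltW K_gt0) // exprMn h2 ysa ler_pdivlMr //.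
  apply: (@le_trans _ _ (norm2 X ^+ 2)); last first.
    by rewrite ler_pXn2r ?nnegrE // ltW.
  rewrite norm2_sq Xsa -sumy mulr_suml tr_sum.
  have -> : tr (y i * y i) * N%:R = \sum_(j < N) tr (y j * y j).
    rewrite (eq_bigr (fun=> tr (y i * y i))).
      by rewrite sumr_const card_ord mulr_natr.
    by move=> j _; rewrite -!expr2; exact: same_moments.
  apply: ler_sum => j _; rewrite mulr_sumr tr_sum (bigD1 j) //= lerDl.
  apply: sumr_ge0 => l lj.
  rewrite (@tr_free_pair _ y j l) ?ytr //; last by apply/eqP; rewrite eq_sym.
  by rewrite -expr2 real_exprn_even_ge0.
split=> //.
  move=> i; rewrite ytr h2 normrM normfV [`|N%:R|]gtr0_norm //.
  by rewrite ler_pM2r ?invr_gt0.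
move=> i b bg.
have form c : gen_subalgebra (y i) c ->
    tr (star c * y i * c) = tr (star c * X * c) - (T - t) * tr (star c * c).
  move=> cg; pose e := c * star c.
  have eg : gen_subalgebra (y i) e.
    by apply: gen_subalgebraM => //; exact: gen_subalgebra_star.
  have trE a : tr (star c * a * c) = tr (a * e).
    by rewrite -mulrA tr_trace -mulrA.
  rewrite !trE; have -> : tr (star c * c) = tr e by rewrite tr_trace.
  rewrite -sumy mulr_suml tr_sum (bigD1 i) //=.
  rewrite (eq_bigr (fun=> t * tr e)); last first.
    by move=> j ji; rewrite (@tr_free_pair _ y j i) ?ytr //; exact/eqP.
  rewrite sumr_const cardC1 card_ord -mulr_natl.
  have -> : N.-1%:R = N%:R - 1 :> C.
    by rewrite -[in RHS](prednK N0) -natr1 addrK.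
  by rewrite /t; field; rewrite gt_eqF.
have X_form (s : C) : s \is Num.real -> `|s| = 1 -> op_pos (K0 *: 1 + s *: X).
  move=> s_real s1 x; rewrite vN_opD !vN_opZ vN_op1 linearDl /= !linearZl_LR /=.
  rewrite -vN_dotE -[s * _]opprK subr_ge0.
  apply: (le_trans (real_ler_norm _)).
    by rewrite rpredN rpredM // sa_dot_real.
  rewrite normrN normrM s1 mul1r; apply: (le_trans (dot_Cauchy_Schwarz _ _)).
  by rewrite expr2 mulrA; apply: ler_wpM2r.
have y_form (s : C) c : s \is Num.real -> `|s| = 1 -> gen_subalgebra (y i) c ->
    0 <= tr (star c * (K *: 1 + s *: y i) * c).
  move=> s_real s1 cg; have s_conj : s^* = s by exact/CrealP.
  rewrite mulrDr mulrDl -!scalerAr -!scalerAl mulr1 trD !trZ form //.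
  have := @op_pos_tr _ _ (K0 *: 1 + s *: X) c _ (X_form s s_real s1).
  rewrite /self_adjoint starD !starZ star1 Xsa s_conj.
  rewrite (CrealP (gtr0_real K0_gt0)) => /(_ erefl).
  rewrite mulrDr mulrDl -!scalerAr -!scalerAl mulr1 trD !trZ => X_ge0.
  apply: (le_trans X_ge0); rewrite mulrBr addrCA [leRHS]addrC lerD2r.
  set beta := tr (star c * c); have beta0 : 0 <= beta := tr_ge0 c.
  rewrite mulrA -mulrBl ler_wpM2r // -subr_ge0 addrAC subr_ge0.
  apply: (@le_trans _ _ (2 * `|T|)); last by rewrite lerBrDl.
  apply: (le_trans (real_ler_norm _)); first by rewrite rpredM // rpredB.
  rewrite normrM s1 mul1r; apply: (le_trans (ler_normB _ _)).
  by rewrite mulr_natl mulr2n lerD2l.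
apply: norm2_mul_of_form => // c cg.
  by have := y_form (- 1) c _ _ cg; rewrite scaleN1r; apply;
    rewrite ?rpredN ?rpred1 ?normrN1.
by have := y_form 1 c _ _ cg; rewrite scale1r; apply; rewrite ?rpred1 ?normr1.
Qed.

End FreeSummands.

(** * Partition-dependent sums *)

Section CrossingWords.
Variables (I : finType) (i0 : I) (k : nat).

(** The four positions are the same for all words of the list, so that counting
    arguments may fix them in advance. *)
Definition crossing_words (L : seq (seq I)) : Prop :=
  [/\ uniq L, forall u, u \in L -> size u = k &
   exists a b d e, [/\ (a < b)%N, (b < d)%N, (d < e)%N, (e < k)%N &
     forall u, u \in L ->
     let v := nth i0 u in [/\ v a = v d, v b = v e & v b <> v d]]].

Lemma crossing_words_rev L :
  crossing_words L -> crossing_words (map rev L).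
Proof.
move=> [uL szL [a [b [d [e [ab bd de ek H]]]]]]; split.
- by rewrite map_inj_uniq //; exact: (can_inj revK).
- by move=> _ /mapP[u /szL uk ->]; rewrite size_rev.
- have dk := ltn_trans de ek; have bk := ltn_trans bd dk.
  have ak := ltn_trans ab bk.
  exists (k - e.+1)%N, (k - d.+1)%N, (k - b.+1)%N, (k - a.+1)%N.
  have mirror p q : (p < q)%N -> (q < k)%N -> (k - q.+1 < k - p.+1)%N.
    by move=> pq qk; apply: ltn_sub2l => //; exact: leq_ltn_trans qk.
  split; [exact: mirror | exact: mirror | exact: mirror | |].
    by rewrite ltn_subrL /= (leq_ltn_trans _ ak).
  move=> _ /mapP[u uL' ->] /=; have uk := szL u uL'.
  have nth_mirror p : (p < k)%N -> nth i0 (rev u) (k - p.+1) = nth i0 u p.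
    move=> pk; rewrite nth_rev uk.
      by rewrite subnSK // subKn // ltnW.
    by rewrite ltn_subrL /= (leq_ltn_trans _ pk).
  rewrite !nth_mirror //; have [-> -> ne] := H u uL'.
  by split=> // /esym.
Qed.

Fixpoint concatenations (Ls : seq (seq (seq I))) : seq (seq I) :=
  if Ls is L :: Ls' then [seq u ++ v | u <- L, v <- concatenations Ls']
  else [:: [::]].

Lemma concatenations_crossing Ls :
  (forall L, L \in Ls -> crossing_words L) ->
  [/\ uniq (concatenations Ls),
    forall u, u \in concatenations Ls -> size u = (size Ls * k)%N &
    forall j, (j < size Ls)%N -> exists a b d e,
     [/\ (a < b)%N, (b < d)%N, (d < e)%N, (e < k)%N &
     forall u, u \in concatenations Ls ->
     let v p := nth i0 u (j * k + p) in
     [/\ v a = v d, v b = v e & v b <> v d]]].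
Proof.
elim: Ls => [|L Ls IH] crossL.
  by split=> // u; rewrite inE => /eqP ->.
have [uL szL [a [b [d [e [ab bd de ek H]]]]]] := crossL L (mem_head _ _).
have [|uZ szZ crossZ] := IH.
  by move=> L' L'in; apply: crossL; rewrite inE L'in orbT.
split.
- apply: allpairs_uniq => // -[u v] [u' v'].
  move=> /allpairsP[[u1 v1] /= [u1L _ [-> ->]]].
  move=> /allpairsP[[u2 v2] /= [u2L _ [-> ->]]] /eqP.
  by rewrite eqseq_cat ?szL // => /andP[/eqP -> /eqP ->].
- move=> _ /allpairsP[[u v] /= [/szL uk /szZ vk ->]].
  by rewrite size_cat uk vk mulSn.
- case=> [_|j jn].
    exists a, b, d, e; split=> // _ /allpairsP[[u v] /= [uL' _ ->]].
    rewrite mul0n !add0n !nth_cat (szL _ uL').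
    have dk := ltn_trans de ek; have bk := ltn_trans bd dk.
    by rewrite (ltn_trans ab bk) bk dk ek; exact: H.
  have [a' [b' [d' [e' [ab' bd' de' ek' H']]]]] := crossZ j jn.
  exists a', b', d', e'; split=> // _ /allpairsP[[u v] /= [uL' vZ ->]].
  have nth_tail p : nth i0 (u ++ v) (j.+1 * k + p) = nth i0 v (j * k + p).
    rewrite nth_cat (szL _ uL') mulSn -addnA ltnNge leq_addr /=.
    by rewrite addKn.
  by rewrite !nth_tail; exact: H'.
Qed.

End CrossingWords.

Section PartitionSums.
Variables (R : realType) (M : tracialVN R).
Local Notation C := R[i].
Local Notation tr := (@tr R M).
Local Notation star := (@vN_star R M).
Local Notation op := (@vN_op R M).

Section Words.
Variables (N : nat) (y : 'I_N -> M).

Definition word_sum (L : seq (seq 'I_N)) : M :=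
  \sum_(u <- L) \prod_(i <- u) y i.

Lemma word_sum_concatenations Ls :
  word_sum (concatenations Ls) = \prod_(L <- Ls) word_sum L.
Proof.
elim: Ls => [|L Ls IH]; first by rewrite /word_sum big_seq1 !big_nil.
rewrite big_cons -IH {1}/word_sum big_allpairs_dep /word_sum mulr_suml.
apply: eq_bigr => u _; rewrite mulr_sumr; apply: eq_bigr => v _.
by rewrite big_cat.
Qed.

Lemma star_word_sum L : (forall i, self_adjoint (y i)) ->
  star (word_sum L) = word_sum (map rev L).
Proof.
move=> ysa; rewrite /word_sum star_sum big_map; apply: eq_bigr => u _.
elim: u => [|i u IH]; first by rewrite !big_nil star1.
by rewrite big_cons starM IH rev_cons big_rcons /= ysa.
Qed.

(** Summing the bound on mixed moments over the words of [Ls]: a code of weight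
    [w] contributes at most [h ^ w] times the number of compatible words, and
    this is at most [h ^ size Ls] because [h ^ 2 = 1 / N]. *)
Lemma tr_crossing_le (k : nat) (i0 : 'I_N) (K : C) (Ls : seq (seq (seq 'I_N))) :
  let h := sqrtC (N%:R^-1) in
  freely_independent y -> 0 <= K ->
  (forall i, `|tr (y i)| <= K * h ^+ 2) ->
  (forall i, norm2 (y i) <= K * h) ->
  (forall i b, gen_subalgebra (y i) b -> norm2 (b * y i) <= K * norm2 b) ->
  (forall L, L \in Ls -> crossing_words i0 k L) ->
  `|tr (word_sum (concatenations Ls))|
    <= (4 * K) ^+ (size Ls * k) * h ^+ size Ls.
Proof.
move=> h y_free K0 y_tr y_norm2 y_mul crossLs.
have N_gt0 : 0 < N%:R :> C by rewrite ltr0n (leq_ltn_trans _ (ltn_ord i0)).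
have h_ge0 : 0 <= h by rewrite sqrtC_ge0 invr_ge0 ltW.
have h2 : h ^+ 2 = N%:R^-1 by rewrite sqrtCK.
have [uZ szZ crossZ] := concatenations_crossing crossLs.
set Z := concatenations Ls in uZ szZ crossZ *.
set m := (size Ls * k)%N in szZ *.
apply: (@le_trans _ _ (\sum_(u <- Z) code_sum K h u [::])).
  rewrite /word_sum tr_sum; apply: (le_trans (ler_norm_sum _ _ _)).
  rewrite big_seq [leRHS]big_seq; apply: ler_sum => u _.
  have := tr_word_le y_free K0 h_ge0 y_tr y_norm2 y_mul u (st := [::]) I.
  by rewrite /stack_prod /= !big_nil mul1r mulr1.
have -> : \sum_(u <- Z) code_sum K h u [::] = \sum_(c <- codes m)
    (size [seq u <- Z | compatible u [::] c])%:R * (K ^+ m * h ^+ weight c).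
  rewrite big_seq (eq_bigr (fun u => \sum_(c <- codes m)
    (compatible u [::] c)%:R * (K ^+ m * h ^+ weight c))); last first.
    by move=> u /szZ um; rewrite /code_sum um.
  rewrite -big_seq exchange_big; apply: eq_bigr => c _; rewrite -mulr_suml.
  congr (_ * _); rewrite size_filter -sum1_count natr_sum [RHS]big_mkcond /=.
  by apply: eq_bigr => u _; case: compatible.
apply: (@le_trans _ _ (\sum_(c <- codes m) K ^+ m * h ^+ size Ls)); last first.
  rewrite big_const_seq count_predT size_codes iter_addr_0.
  by rewrite -[_ *+ (4 ^ m)]mulr_natl natrX exprMn mulrA.
rewrite big_seq [leRHS]big_seq; apply: ler_sum => c /size_in_codes cm.
rewrite mulrCA; apply: ler_wpM2l; first by rewrite exprn_ge0.
set Zc := [seq u <- Z | _].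
have count_le : (size Zc ^ 2 * #|'I_N| ^ size Ls <= #|'I_N| ^ weight c)%N.
  apply: (@card_crossing_words _ k (size Ls) Zc c i0) => //.
  - exact: filter_uniq.
  - by move=> u; rewrite mem_filter => /andP[].
  - move=> j jn; have [a [b [d [e [ab bd de ek H]]]]] := crossZ j jn.
    exists a, b, d, e; split=> // u; rewrite mem_filter => /andP[_].
    exact: H.
rewrite card_ord in count_le.
rewrite -(@ler_pXn2r _ 2) ?nnegrE ?mulr_ge0 ?exprn_ge0 // exprMn.
rewrite -!exprM ![(_ * 2)%N]mulnC !exprM h2 !exprVn.
rewrite ler_pdivrMr ?exprn_gt0 // mulrC ler_pdivlMr ?exprn_gt0 //.
by rewrite -!natrX -natrM ler_nat.
Qed.

End Words.

Lemma tuples_of_type_crossing (k N : nat) (pi : {set {set 'I_k}}) (i0 : 'I_N) :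
  finset.partition pi [set: 'I_k]%SET -> ~ noncrossing pi ->
  crossing_words i0 k
    [seq [seq t j | j <- enum 'I_k]
      | t : {ffun 'I_k -> 'I_N} <- enum (tuples_of_type pi N)].
Proof.
move=> /and3P[_ triv _] /contrapT.
move=> [B [D [a [b [c [d [[Bpi Dpi BD] [[ab bc cd] [aB cB bD dD]]]]]]]]].
have nth_word (t : {ffun 'I_k -> 'I_N}) (p : 'I_k) :
    nth i0 [seq t j | j <- enum 'I_k] p = t p.
  by rewrite (nth_map p) ?size_enum_ord // nth_ord_enum.
split.
- rewrite map_inj_uniq ?enum_uniq // => t t' E; apply/ffunP => p.
  by rewrite -!nth_word E.
- by move=> _ /mapP[t _ ->]; rewrite size_map size_enum_ord.
- exists a, b, c, d; split => //.
  move=> _ /mapP[t + ->]; rewrite mem_enum inE => /forallP typ /=.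
  have typE p q : (t p == t q) = (finset.pblock pi p == finset.pblock pi q).
    by have /forallP/(_ q)/eqP := typ p.
  rewrite !nth_word; split; apply/eqP; rewrite typE.
  + by rewrite (finset.def_pblock triv Bpi aB) (finset.def_pblock triv Bpi cB).
  + by rewrite (finset.def_pblock triv Dpi bD) (finset.def_pblock triv Dpi dD).
  + by rewrite (finset.def_pblock triv Dpi bD) (finset.def_pblock triv Bpi cB)
      eq_sym.
Qed.

(** The moments of [star S * S] are sums over concatenations of [2 n] words, which
    are all crossing because reversal preserves crossings. *)
Lemma partition_sum_bound (k N : nat) (pi : {set {set 'I_k}}) (y : 'I_N -> M)
    (K : C) :
  let h := sqrtC (N%:R^-1) in
  (0 < N)%N -> finset.partition pi [set: 'I_k]%SET -> ~ noncrossing pi ->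
  (forall i, self_adjoint (y i)) -> freely_independent y -> 0 < K ->
  (forall i, `|tr (y i)| <= K * h ^+ 2) ->
  (forall i, norm2 (y i) <= K * h) ->
  (forall i b, gen_subalgebra (y i) b -> norm2 (b * y i) <= K * norm2 b) ->
  op_bound (partition_sum pi y) ((4 * K) ^+ k * h).
Proof.
move=> h N0 piP pi_cross ysa y_free K0 y_tr y_norm2 y_mul x.
pose i0 := Ordinal N0; pose L := [seq [seq t j | j <- enum 'I_k]
  | t : {ffun 'I_k -> 'I_N} <- enum (tuples_of_type pi N)].
have crossL : crossing_words i0 k L by exact: tuples_of_type_crossing.
have h_gt0 : 0 < h by rewrite sqrtC_gt0 invr_gt0 ltr0n.
have SL : partition_sum pi y = word_sum y L.
  rewrite /partition_sum /word_sum big_map big_enum /=; apply: eq_bigr => t _.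
  by rewrite big_map enumT; apply: congr_big; rewrite // /index_enum unlock.
have K4 : 0 < 4 * K by rewrite mulr_gt0.
rewrite -(@ler_pXn2r _ 2) ?nnegrE ?mulr_ge0 ?exprn_ge0 ?(ltW h_gt0)
  ?(ltW K4) //.
rewrite exprMn; apply: op_bound_of_moments => [|n].
  by rewrite exprn_gt0 // mulr_gt0 // exprn_gt0.
rewrite SL (star_word_sum _ ysa).
pose Ls := flatten (nseq n [:: map rev L; L]).
have szLs : size Ls = (n * 2)%N.
  by rewrite /Ls size_flatten /shape map_nseq sumn_nseq mulnC.
have -> : (word_sum y (map rev L) * word_sum y L) ^+ n
    = word_sum y (concatenations Ls).
  rewrite word_sum_concatenations /Ls; elim: n {Ls szLs} => [|n IH].
    by rewrite big_nil.
  by rewrite exprS IH /= !big_cons mulrA.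
have crossLs L' : L' \in Ls -> crossing_words i0 k L'.
  move=> /flattenP[s /nseqP[-> _]]; rewrite !inE => /orP[/eqP->|/eqP-> //].
  exact: crossing_words_rev.
apply: (le_trans (tr_crossing_le y_free (ltW K0) y_tr y_norm2 y_mul crossLs)).
have E : ((4 * K) ^+ k * h) ^+ 2 ^+ n
    = (4 * K) ^+ (n * 2 * k) * h ^+ (n * 2) :> C.
  by rewrite -exprM [(2 * n)%N]mulnC exprMn -exprM [(k * _)%N]mulnC.
by rewrite szLs -/h E.
Qed.

Lemma opnorm_le (a : M) (K : R) :
  0 <= K -> op_bound a K%:C%C -> opnorm a <= K.
Proof.
move=> K0 aK; apply: ge_sup.
  by exists (complex.Re `|op a 0|), 0 => //=; rewrite normr0.
move=> _ [x /= x1 <-]; rewrite -lecR RRe_real ?normr_real //.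
by apply: (le_trans (aK x)); rewrite ler_piMr // ler0c.
Qed.

Lemma opnorm_ge0 (a : M) (K : R) : 0 <= K -> op_bound a K%:C%C -> 0 <= opnorm a.
Proof.
move=> K0 aK; apply: ub_le_sup.
  exists K => _ [x /= x1 <-]; rewrite -lecR RRe_real ?normr_real //.
  by apply: (le_trans (aK x)); rewrite ler_piMr // ler0c.
by exists 0 => /=; rewrite ?normr0 // vN_op_v0 normr0.
Qed.



(** The constant [K] depends on [X] only, so the operator norms are of order
    [N ^ (- 1 / 2)]. *)
Lemma crossing_measure_eq0 (X : M) (Y : forall N : nat, 'I_N -> M) (k : nat)
    (pi : {set {set 'I_k}}) :
  free_triangular_array X Y -> finset.partition pi [set: 'I_k]%SET ->
  ~ noncrossing pi -> is_stochastic_measure pi Y 0.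
Proof.
move=> Y_array piP pi_cross.
have [K K1 estimates] := free_summand_estimates X.
have K0 : 0 < K by apply: lt_le_trans K1.
have K_real : (complex.Re K)%:C%C = K by rewrite RRe_real ?gtr0_real.
pose c : R := (4 * complex.Re K) ^+ k.
have c0 : 0 <= c.
  by rewrite exprn_ge0 // mulr_ge0 // -ler0c K_real ltW.
have bound N : op_bound (partition_sum pi (Y N.+1) - 0)
    (c * Num.sqrt (N.+1%:R^-1))%:C%C.
  rewrite subr0; have [ysa y_free y_id y_sum] := Y_array N.+1 isT.
  have [y_tr y_norm2 y_mul] := estimates _ _ (ltn0Sn N) ysa y_free y_id y_sum.
  have -> : (c * Num.sqrt (N.+1%:R^-1))%:C%C
      = (4 * K) ^+ k * sqrtC (N.+1%:R^-1) :> C.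
    rewrite rmorphM rmorphXn rmorphM /= K_real rmorph_nat; congr (_ * _).
    apply/eqP; rewrite -(@eqrXn2 _ 2) ?ler0c ?sqrtr_ge0 ?sqrtC_ge0 //.
      by rewrite sqrtCK -rmorphXn sqr_sqrtr // fmorphV rmorph_nat.
  exact: partition_sum_bound.
(* the row of index 0 is not constrained *)
rewrite /is_stochastic_measure -cvg_shiftS.
apply: (@squeeze_cvgr _ _ _ _ (fun=> 0)
  (fun N => c * Num.sqrt (N.+1%:R^-1))).
- near=> N; rewrite (opnorm_le _ (bound N)) ?(opnorm_ge0 _ (bound N)) //.
    by rewrite mulr_ge0 // sqrtr_ge0.
  by rewrite mulr_ge0 // sqrtr_ge0.
- exact: cvg_cst.
- rewrite -[0](mulr0 c); apply: cvgMr; rewrite -sqrtr0.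
  apply: (cvg_comp _ _ cvg_harmonic); exact: sqrt_continuous.
Unshelve. all: by end_near. Qed.

End PartitionSums.

Theorem theorem1 (R : realType) (M : tracialVN R)
    (mu : probability R R) (mu_ : R -> probability R R)
    (mu_compact : compactly_supported mu)
    (mu_fid : freely_infinitely_divisible mu)
    (mu_variance : ('V_mu[idfun : R -> R] = 1)%E)
    (mu_semigroup : free_convolution_semigroup mu_)
    (mu_1 : forall U : set R, measurable U -> mu_ 1 U = mu U)
    (X : set R -> M) (X_process : free_increments_process mu_ X)
    (A : set R) (A_union : finite_union_of_intervals A)
    (Y : forall N : nat, 'I_N -> M)
    (Y_array : free_triangular_array (X A) Y)
    (k : nat) (k_gt0 : (0 < k)%N)
    (pi : {set {set 'I_k}}) (pi_partition : finset.partition pi [set: 'I_k]%SET)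
    (pi_crossing : ~ noncrossing pi) :
  is_stochastic_measure pi Y 0.
Proof. exact: (crossing_measure_eq0 Y_array pi_partition pi_crossing). Qed.
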